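(* Let $(M,I,J,K)$ be a compact hypercomplex manifold satisfying the $\partial\partial_J$-lemma. Then the triple $\partial$-Massey products vanish.
   Context: A hypercomplex manifold $(M,I,J,K)$ is a smooth manifold with three integrable complex structures that pairwise anticommute and satisfy $IJ=K$. $A^{p,q}(M)$ denotes smooth complex $(p,q)$-forms with respect to $I$; $\partial,\bar\partial$ are the Dolbeault operators of $I$, and $H^{p,0}_\partial(M)=\ker(\partial|_{A^{p,0}(M)})/\partial A^{p-1,0}(M)$. $J$ acts on $k$-forms by $(J\alpha)(X_1,\dots,X_k)=\alpha(JX_1,\dots,JX_k)$, and $\partial_J:=J^{-1}\bar\partial J\colon A^{p,0}(M)\to A^{p+1,0}(M)$; $\partial$ and $\partial_J$ square to zero and anticommute. The $\partial\partial_J$-lemma holds on $M$ if, on $A^{p,0}(M)$ for all $p$, $\mathrm{Im}\,\partial\cap\ker\partial_J=\mathrm{Im}\,\partial\partial_J$ and $\mathrm{Im}\,\partial_J\cap\ker\partial=\mathrm{Im}\,\partial\partial_J$. Triple $\partial$-Massey products: let $\mathfrak a=[\alpha]\in H^{p,0}_\partial(M)$, $\mathfrak b=[\beta]\in H^{q,0}_\partial(M)$, $\mathfrak c=[\gamma]\in H^{r,0}_\partial(M)$ with $\mathfrak a\cup\mathfrak b=0$ and $\mathfrak b\cup\mathfrak c=0$, say $\alpha\wedge\beta=\partial\lambda$ and $\beta\wedge\gamma=\partial\mu$ with $\lambda\in A^{p+q-1,0}(M)$, $\mu\in A^{q+r-1,0}(M)$. Then $$\langle\mathfrak a,\mathfrak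 b,\mathfrak c\rangle:=[\lambda\wedge\gamma-(-1)^p\alpha\wedge\mu]\in\frac{H^{p+q+r-1,0}_\partial(M)}{H^{p+q-1,0}_\partial(M)\cup H^{r,0}_\partial(M)+H^{p,0}_\partial(M)\cup H^{q+r-1,0}_\partial(M)}.$$ The triple $\partial$-Massey products vanish if all these classes, whenever defined, are zero. *)

(* Defs.v *)
From HB Require Import structures.
From mathcomp Require Import all_boot all_order all_algebra.
From mathcomp Require Import boolp classical_sets functions reals topology.
From mathcomp Require Import normedtype derive.
From mathcomp Require Import complex ring.

Set Implicit Arguments.
Unset Strict Implicit.
Unset Printing Implicit Defensive.

Import Order.TTheory GRing.Theory Num.Theory numFieldNormedType.Exports.

Local Open Scope classical_set_scope.
Local Open Scope ring_scope.
Local Open Scope complex_scope.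

Section SmoothEuclidean.
Variables (R : realType) (n : nat).
Implicit Types (V : set 'rV[R]_n) (f g : 'rV[R]_n -> R).

(* Meaningful for V open. *)
Fixpoint Ck (k : nat) V f : Prop :=
  (forall x, V x -> {for x, continuous f}) /\
  (if k is k'.+1 then
     forall i : 'I_n, (forall x, V x -> derivable f x (delta_mx 0 i)) /\
       Ck k' V (fun x => 'D_(delta_mx 0 i) f x)
   else True).

Definition Cinfty V f := forall k, Ck k V f.

Lemma Ck_cont k V f x : Ck k V f -> V x -> {for x, continuous f}.
Proof. by case: k => [|k] [h _] Vx; apply: h. Qed.

Lemma CkW k V f : Ck k.+1 V f -> Ck k V f.
Proof.
elim: k f => [|k IH] f [cf df]; first by split.
by split=> // i; have [d1 d2] := df i; split=> //; apply: IH.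
Qed.

Lemma Ck_ext k V f g : open V -> (forall x, V x -> f x = g x) ->
  Ck k V f -> Ck k V g.
Proof.
move=> oV; elim: k f g => [|k IH] f g fg [cf df].
  split=> // x Vx.
  have nfg : \near x, f x = g x.
    by apply: filterS (open_nbhs_nbhs (conj oV Vx)) => y; apply: fg.
  rewrite /prop_for /continuous_at -(fg _ Vx).
  by apply: cvg_trans (cf x Vx); apply: (near_eq_cvg (F := nbhs x)).
have nfg x : V x -> \near x, f x = g x.
  by move=> Vx; apply: filterS (open_nbhs_nbhs (conj oV Vx)) => y; apply: fg.
split=> [x Vx|i].
  rewrite /prop_for /continuous_at -(fg _ Vx).
  by apply: cvg_trans (cf x Vx); apply: (near_eq_cvg (F := nbhs x)) (nfg _ Vx).
have [d1 d2] := df i; split=> [x Vx|].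
  by apply: near_eq_derivable (d1 x Vx); apply: nfg.
by apply: IH d2 => x Vx; apply: near_eq_derive; apply: nfg.
Qed.

Lemma Ck_cst k V (a : R) : Ck k V (fun=> a).
Proof.
elim: k a => [|k IH] a; split=> //; first by move=> x _; exact: cst_continuous.
  by move=> x _; exact: cst_continuous.
move=> i; split=> [x _|]; first exact: derivable_cst.
suff -> : (fun x => 'D_(delta_mx 0 i) (fun=> a) x) =
          (fun=> 0) :> ('rV[R]_n -> R).
  exact: IH.
by apply/funext => x; rewrite derive_cst.
Qed.

Lemma CkD k V f g : open V -> Ck k V f -> Ck k V g ->
  Ck k V (fun x => f x + g x).
Proof.
move=> oV; elim: k f g => [|k IH] f g [cf df] [cg dg].
  by split=> // x Vx; apply: (cvgD (F := nbhs x)) (cf x Vx) (cg x Vx).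
split=> [x Vx|i]; first by apply: (cvgD (F := nbhs x)) (cf x Vx) (cg x Vx).
have [f1 f2] := df i; have [g1 g2] := dg i; split=> [x Vx|].
  by apply: derivableD; [exact: f1|exact: g1].
apply: Ck_ext oV _ (IH _ _ f2 g2) => x Vx.
by rewrite -deriveD; [|exact: f1|exact: g1].
Qed.

Lemma CkM k V f g : open V -> Ck k V f -> Ck k V g ->
  Ck k V (fun x => f x * g x).
Proof.
move=> oV; elim: k f g => [|k IH] f g Cf Cg.
  by split=> // x Vx; apply: (cvgM (F := nbhs x)) (Ck_cont Cf Vx) (Ck_cont Cg Vx).
split=> [x Vx|i].
  by apply: (cvgM (F := nbhs x)) (Ck_cont Cf Vx) (Ck_cont Cg Vx).
have [_ df] := Cf; have [_ dg] := Cg.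
have [f1 f2] := df i; have [g1 g2] := dg i; split=> [x Vx|].
  by apply: derivableM; [exact: f1|exact: g1].
apply: Ck_ext oV _ (CkD oV (IH _ _ (CkW Cf) g2) (IH _ _ (CkW Cg) f2)) => x Vx.
by rewrite deriveM; [|exact: f1|exact: g1].
Qed.

End SmoothEuclidean.

Record chart (R : realType) (n : nat) (M : topologicalType) := Chart {
  chart_dom : set M;
  chart_map : M -> 'rV[R]_n;
  chart_inv : 'rV[R]_n -> M;
  chart_open : open chart_dom;
  chart_open_im : open (chart_map @` chart_dom);
  chart_mapK : forall x, chart_dom x -> chart_inv (chart_map x) = x;
  chart_map_cont : forall x, chart_dom x -> {for x, continuous chart_map};
  chart_inv_cont : forall y, (chart_map @` chart_dom) y ->
    {for y, continuous chart_inv} }.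

Definition chart_compat (R : realType) n (M : topologicalType)
    (c c' : chart R n M) : Prop :=
  forall i : 'I_n, Cinfty (chart_map c @` (chart_dom c `&` chart_dom c'))
    (fun y => chart_map c' (chart_inv c y) 0 i).

Record manifold (R : realType) (n : nat) := Manifold {
  carrier :> topologicalType;
  manifold_hausdorff : hausdorff_space carrier;
  manifold_countable : @second_countable carrier;
  atlas : set (chart R n carrier);
  atlas_cover : forall x, exists2 c, atlas c & chart_dom c x;
  atlas_compat : forall c c', atlas c -> atlas c' -> chart_compat c c' }.

Section SmoothFunctions.
Variables (R : realType) (n : nat) (M : manifold R n).

Definition smooth_real (f : M -> R) : Prop := forall c, atlas c ->
  Cinfty (chart_map c @` chart_dom c) (f \o chart_inv c).

Definition smooth (f : M -> R[i]) : Prop :=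
  smooth_real (fun x => complex.Re (f x)) /\
  smooth_real (fun x => complex.Im (f x)).

Definition smooth_pred : {pred M -> R[i]} := fun f => `[< smooth f >].

Lemma smooth_real_cst (a : R) : smooth_real (fun=> a).
Proof. by move=> c _ k; exact: Ck_cst. Qed.

Lemma smooth_realD f g : smooth_real f -> smooth_real g ->
  smooth_real (fun x => f x + g x).
Proof.
move=> sf sg c ac k; apply: CkD; [exact: chart_open_im|exact: sf|exact: sg].
Qed.

Lemma smooth_realM f g : smooth_real f -> smooth_real g ->
  smooth_real (fun x => f x * g x).
Proof.
move=> sf sg c ac k; apply: CkM; [exact: chart_open_im|exact: sf|exact: sg].
Qed.

Lemma smooth_realN f : smooth_real f -> smooth_real (fun x => - f x).
Proof.
move=> sf; rewrite (_ : (fun x => _) = (fun x => -1 * f x)).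
  by apply: smooth_realM => //; exact: smooth_real_cst.
by apply/funext => x; rewrite mulN1r.
Qed.

Lemma smooth_subring : subring_closed smooth_pred.
Proof.
split.
- by apply/asboolP; split; exact: smooth_real_cst.
- move=> f g /asboolP[f1 f2] /asboolP[g1 g2]; apply/asboolP; split.
    have := smooth_realD f1 (smooth_realN g1); congr smooth_real.
    by apply/funext => x; rewrite [(f - g) x]/(f x - g x);
      case: (f x) (g x) => a b [].
  have := smooth_realD f2 (smooth_realN g2); congr smooth_real.
  by apply/funext => x; rewrite [(f - g) x]/(f x - g x);
      case: (f x) (g x) => a b [].
- move=> f g /asboolP[f1 f2] /asboolP[g1 g2]; apply/asboolP; split.
    have := smooth_realD (smooth_realM f1 g1) (smooth_realN (smooth_realM f2 g2)).
    congr smooth_real.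
    apply/funext => x; rewrite [(f * g) x]/(f x * g x).
    by case: (f x) (g x) => a b [].
  have := smooth_realD (smooth_realM f1 g2) (smooth_realM f2 g1).
  congr smooth_real.
  apply/funext => x; rewrite [(f * g) x]/(f x * g x).
  by case: (f x) (g x) => a b [].
Qed.

HB.instance Definition _ :=
  GRing.isSubringClosed.Build (M -> R[i]) smooth_pred smooth_subring.

(* The commutative ring C^oo(M, C). *)
Record cinf := Cinf { cinf_fun :> M -> R[i]; _ : cinf_fun \in smooth_pred }.

HB.instance Definition _ := [isSub for cinf_fun].
HB.instance Definition _ := [Choice of cinf by <:].
HB.instance Definition _ := GRing.SubChoice_isSubComPzRing.Build
  (M -> R[i]) smooth_pred cinf smooth_subring.

Lemma cconst_subproof (c : R[i]) : (fun=> c) \in smooth_pred.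
Proof. by apply/asboolP; split; exact: smooth_real_cst. Qed.
Definition cconst (c : R[i]) : cinf := Cinf (cconst_subproof c).

Lemma cconj_subproof (f : cinf) : (fun x => conjc (f x)) \in smooth_pred.
Proof.
case: f => f /= /asboolP[f1 f2]; apply/asboolP; split.
  by move: f1; congr smooth_real; apply/funext => x; case: (f x).
by have := smooth_realN f2; congr smooth_real; apply/funext => x; case: (f x).
Qed.
Definition cconj (f : cinf) : cinf := Cinf (cconj_subproof f).

End SmoothFunctions.

Lemma leibniz_lin (B : comPzRingType) (a x y z w f g : B) :
  a * (x * g + f * y) + (z * g + f * w) = (a * x + z) * g + f * (a * y + w).
Proof. ring. Qed.

Lemma leibniz_lie (B : comPzRingType) (zf zg wf wg zwf zwg wzf wzg f g : B) :
  (zwf * g + wf * zg + (zf * wg + f * zwg)) -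
    (wzf * g + zf * wg + (wf * zg + f * wzg)) =
  (zwf - wzf) * g + f * (zwg - wzg).
Proof. ring. Qed.

Section VectorFields.
Variables (R : realType) (n : nat) (M : manifold R n).
Local Notation A := (cinf M).

Definition derivation (Z : A -> A) : Prop :=
  (forall (c : R[i]) (f g : A),
     Z (cconst M c * f + g) = cconst M c * Z f + Z g) /\
  (forall f g : A, Z (f * g) = Z f * g + f * Z g).

Definition derivation_pred : {pred A -> A^o} := fun Z => `[< derivation Z >].

Lemma derivation_submod : submod_closed derivation_pred.
Proof.
split.
  apply/asboolP; split=> [c f g|f g]; rewrite /GRing.zero/=.
    by rewrite mulr0 addr0.
  by rewrite mul0r mulr0 addr0.
move=> a Z W /asboolP[Zl ZM] /asboolP[Wl WM]; apply/asboolP.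
have E f : (a *: Z + W) f = a * Z f + W f by [].
split=> [c f g|f g]; rewrite !E.
  by rewrite Zl Wl !mulrDr addrACA mulrCA.
rewrite ZM WM; exact: leibniz_lin.
Qed.

HB.instance Definition _ := GRing.isSubmodClosed.Build A (A -> A^o)
  derivation_pred derivation_submod.

(* Sections of the complexified tangent bundle, as the C-linear derivations of
   C^oo(M, C). *)
Record vfield := VField {
  vfield_fun :> A -> A^o; _ : vfield_fun \in derivation_pred }.

HB.instance Definition _ := [isSub for vfield_fun].
HB.instance Definition _ := [Choice of vfield by <:].
HB.instance Definition _ := [SubChoice_isSubLmodule of vfield by <:].

Lemma lie_subproof (Z W : vfield) :
  (fun f => Z (W f) - W (Z f)) \in derivation_pred.
Proof.
case: Z W => Z /= /asboolP[Zl ZM] [W /= /asboolP[Wl WM]].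
have ZD f g : Z (f + g) = Z f + Z g.
  by have := Zl 1 f g; rewrite (_ : cconst M 1 = 1) ?mul1r //; apply: val_inj.
have WD f g : W (f + g) = W f + W g.
  by have := Wl 1 f g; rewrite (_ : cconst M 1 = 1) ?mul1r //; apply: val_inj.
apply/asboolP; split=> [c f g|f g].
  by rewrite Wl Zl Zl Wl mulrBr opprD addrACA.
rewrite WM ZM ZD WD !ZM !WM; exact: leibniz_lie.
Qed.
Definition lie (Z W : vfield) : vfield := VField (lie_subproof Z W).

Definition real_field (Z : vfield) : Prop :=
  forall f : A, Z (cconj f) = cconj (Z f).

(* Endomorphisms of the real tangent bundle, extended complex-linearly. *)
Definition almost_complex (I : vfield -> vfield) : Prop :=
  [/\ forall (f : A) Z W, I (f *: Z + W) = f *: I Z + I W,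
      forall Z, real_field Z -> real_field (I Z) &
      forall Z, I (I Z) = - Z].

Definition nijenhuis (I : vfield -> vfield) Z W : vfield :=
  lie (I Z) (I W) - I (lie (I Z) W) - I (lie Z (I W)) - lie Z W.

(* Integrability is the vanishing of the Nijenhuis tensor (equivalent to the
   existence of holomorphic charts by Newlander-Nirenberg). *)
Definition complex_structure (I : vfield -> vfield) : Prop :=
  almost_complex I /\ forall Z W, nijenhuis I Z W = 0.

End VectorFields.

Section Forms.
Variables (R : realType) (n : nat) (M : manifold R n).
Local Notation A := (cinf M).
Local Notation T := (vfield M).

(* A form is evaluated on finite sequences of complex vector fields; its
   degree-k component is its restriction to sequences of size k. Homogeneous
   forms vanish on sequences of any other size. *)
Definition dform := seq T -> A.

(* C^oo(M, C)-multilinear and alternating in each degree. *)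
Definition is_form (w : dform) : Prop :=
  (forall s1 s2 (f : A) Z W,
     w (s1 ++ (f *: Z + W) :: s2) =
       f * w (s1 ++ Z :: s2) + w (s1 ++ W :: s2)) /\
  (forall s1 s2 s3 Z, w (s1 ++ Z :: s2 ++ Z :: s3) = 0).

(* The sign of the shuffle moving the positions selected by m to the front. *)
Definition inversions (m : bitseq) : nat :=
  (\sum_(j < size m) \sum_(i < j) (~~ nth false m i && nth false m j))%N.

Definition wedge (a b : dform) : dform := fun s =>
  \sum_(m : (size s).-tuple bool)
    (-1) ^+ inversions m * a (mask m s) * b (mask (map negb m) s).

Definition omit (i : nat) (s : seq T) := take i s ++ drop i.+1 s.

(* The exterior derivative, by Koszul's formula. *)
Definition dext (w : dform) : dform := fun s =>
  \sum_(i < size s) (-1) ^+ i * (nth 0 s i) (w (omit i s)) +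
  \sum_(j < size s) \sum_(i < j)
    (-1) ^+ (i + j) * w (lie (nth 0 s i) (nth 0 s j) :: omit i (omit j s)).

Definition pullback (F : T -> T) (w : dform) : dform := fun s => w (map F s).

Section Dolbeault.
Variable I : T -> T.

(* The (1,0)-part of Z if b, its (0,1)-part otherwise. *)
Definition part (b : bool) (Z : T) : T :=
  cconst M 2^-1 *:
    (if b then Z - cconst M 'i *: I Z else Z + cconst M 'i *: I Z).

Definition parts (m : bitseq) (s : seq T) : seq T :=
  [seq part x.1 x.2 | x <- zip m s].

Definition has_type (p q : int) (m : bitseq) : bool :=
  ((count id m)%:Z == p) && ((count negb m)%:Z == q).

(* A^{p,q}(M); it is 0 if p or q is negative. *)
Definition Apq (p q : int) : set dform :=
  [set w | is_form w /\
    forall m s, size m = size s -> ~~ has_type p q m -> w (parts m s) = 0].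

Definition proj (p q : int) (w : dform) : dform := fun s =>
  \sum_(m : (size s).-tuple bool | has_type p q m) w (parts m s).

(* On A^{p,q}, del is the (p+1,q)-part of dext and delbar its (p,q+1)-part. *)
Definition del (w : dform) : dform := fun s =>
  \sum_(p < size s) let q := (size s - p.+1)%N in
    proj p.+1 q (dext (proj p q w)) s.

Definition delbar (w : dform) : dform := fun s =>
  \sum_(p < size s) let q := (size s - p.+1)%N in
    proj p q.+1 (dext (proj p q w)) s.

End Dolbeault.
End Forms.

Record hypercomplex (R : realType) (n : nat) (M : manifold R n) :=
  Hypercomplex {
  cI : vfield M -> vfield M;
  cJ : vfield M -> vfield M;
  cK : vfield M -> vfield M;
  cI_complex : complex_structure cI;
  cJ_complex : complex_structure cJ;
  cK_complex : complex_structure cK;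
  cIJ : forall Z, cI (cJ Z) = - cJ (cI Z);
  cJK : forall Z, cJ (cK Z) = - cK (cJ Z);
  cIK : forall Z, cI (cK Z) = - cK (cI Z);
  cIJK : forall Z, cI (cJ Z) = cK Z }.

Section Massey.
Variables (R : realType) (n : nat) (M : manifold R n) (H : hypercomplex M).
Local Notation d1 := (del (cI H)).

Definition Ap0 (p : int) : set (dform M) := Apq (cI H) p 0.

(* J^{-1} delbar J, where J^{-1} = - J on vector fields. *)
Definition delJ (w : dform M) : dform M :=
  pullback (fun Z => - cJ H Z) (delbar (cI H) (pullback (cJ H) w)).

Definition ddJ_lemma : Prop := forall p : nat,
  (d1 @` Ap0 (p%:Z - 1)) `&` (Ap0 p `&` [set w | delJ w = 0]) =
    (d1 \o delJ) @` Ap0 (p%:Z - 2) /\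
  (delJ @` Ap0 (p%:Z - 1)) `&` (Ap0 p `&` [set w | d1 w = 0]) =
    (d1 \o delJ) @` Ap0 (p%:Z - 2).

Definition cocycles (p : int) : set (dform M) := Ap0 p `&` [set w | d1 w = 0].
Definition coboundaries (p : int) : set (dform M) := d1 @` Ap0 (p - 1).

(* Cocycles representing the elements of the subspace of cohomology spanned by
   the products of classes of degrees p and q. *)
Definition cup_span (p q : int) : set (dform M) :=
  [set w | exists s : seq (dform M * dform M),
     (forall x, x \in s -> cocycles p x.1 /\ cocycles q x.2) /\
     w = \sum_(x <- s) wedge x.1 x.2].

(* Vanishing of the class of the cocycle w in H^{p+q+r-1,0} modulo
   H^{p+q-1,0} u H^{r,0} + H^{p,0} u H^{q+r-1,0}. *)
Definition massey_zero (p q r : nat) (w : dform M) : Prop :=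
  exists b u v, [/\ coboundaries ((p + q + r)%:Z - 1) b,
    cup_span ((p + q)%:Z - 1) r u, cup_span p ((q + r)%:Z - 1) v &
    w = b + u + v].

Definition massey_vanish : Prop :=
  forall (p q r : nat) (alpha beta gamma lambda mu : dform M),
  cocycles p alpha -> cocycles q beta -> cocycles r gamma ->
  Ap0 ((p + q)%:Z - 1) lambda -> Ap0 ((q + r)%:Z - 1) mu ->
  wedge alpha beta = d1 lambda -> wedge beta gamma = d1 mu ->
  massey_zero p q r
    (wedge lambda gamma - (-1) ^+ p \*o wedge alpha mu).

End Massey.

(* Main.v *)
(* The operators i_Z (contraction) and L_Z (Lie derivative) give recursions for
   the wedge product and for d (Cartan's formula), from which the Leibniz rule,
   associativity and d d = 0 follow by induction on the list of arguments. On
   forms of type (p,0) for I, both del and delJ are of the shape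
   rho^* d sigma^*, where rho identifies T^{1,0}_I with T^{1,0}_I, resp.
   T^{0,1}_I (via - J), and sigma is inverse to it. Their sum is again of this
   shape, with rho = 1 - J mapping T^{1,0}_I onto T^{1,0}_K; as these three
   bundles are involutive, all three operators square to zero, and hence del
   and delJ anticommute.

   The lemma then provides delJ-closed representatives a, b, c of the three
   classes, and primitives delJ l of a b and delJ m of b c. For these choices the
   Massey cocycle is delJ (l c - a m), which is both delJ-exact and del-closed,
   hence del-exact. Changing the representatives and the primitives alters the
   Massey cocycle by exact forms and by elements of the indeterminacy. *)

Require Import Defs.
From mathcomp Require Import all_boot all_order all_algebra.
From mathcomp Require Import boolp classical_sets functions reals topology.
From mathcomp Require Import complex ring.

Set Implicit Arguments.
Unset Strict Implicit.
Unset Printing Implicit Defensive.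

Import Order.TTheory GRing.Theory Num.Theory.

Local Open Scope classical_set_scope.
Local Open Scope ring_scope.
Local Open Scope complex_scope.

(** * Vector fields and forms *)

Section VectorFieldTheory.
Context (R : realType) (n : nat) (M : manifold R n).
Local Notation A := (cinf M).
Local Notation T := (vfield M).
Implicit Types (X Y Z W : T) (f g : A).

Lemma vfield_ext X Y : (forall f, X f = Y f) -> X = Y.
Proof. by move=> XY; apply/val_inj/funext. Qed.

Lemma cconst1 : cconst M 1 = 1.
Proof. exact: val_inj. Qed.

Lemma cconstD a b : cconst M (a + b) = cconst M a + cconst M b.
Proof. exact: val_inj. Qed.

Lemma cconstM a b : cconst M (a * b) = cconst M a * cconst M b.
Proof. exact: val_inj. Qed.

Lemma cconstN a : cconst M (- a) = - cconst M a.
Proof. exact: val_inj. Qed.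

Lemma vfieldD Z f g : Z (f + g) = Z f + Z g.
Proof.
by case: Z => Z /= /asboolP[ZL _]; have := ZL 1 f g; rewrite cconst1 !mul1r.
Qed.

Lemma vfieldM Z f g : Z (f * g) = Z f * g + f * Z g.
Proof. by case: Z => Z /= /asboolP[_]; apply. Qed.

Lemma vfield0 Z : Z 0 = 0.
Proof. by have /eqP := vfieldD Z 0 0; rewrite addr0 -subr_eq subrr => /eqP. Qed.

Lemma vfieldN Z f : Z (- f) = - Z f.
Proof. by apply/eqP; rewrite -addr_eq0 -vfieldD addNr vfield0. Qed.

Lemma vfieldB Z f g : Z (f - g) = Z f - Z g.
Proof. by rewrite vfieldD vfieldN. Qed.

Lemma vaddE X Y f : (X + Y) f = X f + Y f. Proof. by []. Qed.
Lemma voppE X f : (- X) f = - X f. Proof. by []. Qed.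
Lemma vscaleE g X f : (g *: X) f = g * X f. Proof. by []. Qed.
Lemma vzeroE f : (0 : T) f = 0. Proof. by []. Qed.
Lemma lieE X Y f : lie X Y f = X (Y f) - Y (X f). Proof. by []. Qed.

Definition vfieldE := (vaddE, voppE, vscaleE, vzeroE, lieE).

Lemma lieC X Y : lie X Y = - lie Y X.
Proof. by apply: vfield_ext => f; rewrite !vfieldE opprB. Qed.

Lemma liexx X : lie X X = 0.
Proof. by apply: vfield_ext => f; rewrite !vfieldE subrr. Qed.

Lemma lieZDr Z f X Y :
  lie Z (f *: X + Y) = f *: lie Z X + (Z f *: X + lie Z Y).
Proof. by apply: vfield_ext => g; rewrite !vfieldE vfieldD vfieldM; ring. Qed.

Lemma lieDr Z X Y : lie Z (X + Y) = lie Z X + lie Z Y.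
Proof. by apply: vfield_ext => g; rewrite !vfieldE vfieldD; ring. Qed.

Lemma lieDl X Y Z : lie (X + Y) Z = lie X Z + lie Y Z.
Proof. by apply: vfield_ext => g; rewrite !vfieldE vfieldD; ring. Qed.

Lemma lieNr Z X : lie Z (- X) = - lie Z X.
Proof. by apply: vfield_ext => g; rewrite !vfieldE vfieldN; ring. Qed.

Lemma lieNl X Z : lie (- X) Z = - lie X Z.
Proof. by rewrite lieC lieNr -lieC. Qed.

Lemma lie_jacobi X Y Z : lie (lie X Y) Z = lie X (lie Y Z) - lie Y (lie X Z).
Proof. by apply: vfield_ext => g; rewrite !vfieldE !vfieldB; ring. Qed.

End VectorFieldTheory.

(** * Alternating forms and contractions *)

Section FormTheory.
Context (R : realType) (n : nat) (M : manifold R n).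
Local Notation A := (cinf M).
Local Notation T := (vfield M).
Implicit Types (X Y Z W : T) (f g : A) (s : seq T) (u v w a b c : dform M).

Lemma daddE u v s : (u + v) s = u s + v s. Proof. by []. Qed.
Lemma doppE u s : (- u) s = - u s. Proof. by []. Qed.
Lemma dzeroE s : (0 : dform M) s = 0. Proof. by []. Qed.

Definition dformE := (daddE, doppE, dzeroE).

Definition contr Z w : dform M := fun s => w (Z :: s).

(** The grading involution. It carries the sign of the graded Leibniz rules, so that these need no
    mention of a degree and hold for inhomogeneous forms as well. *)
Definition bar w : dform M := fun s => (-1) ^+ size s * w s.

Definition multilinear w := forall s1 s2 f Z W,
  w (s1 ++ (f *: Z + W) :: s2) = f * w (s1 ++ Z :: s2) + w (s1 ++ W :: s2).

Definition alternating w := forall s1 s2 Z, w (s1 ++ Z :: Z :: s2) = 0.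

Section Multilinear.
Variable w : dform M.
Hypothesis wL : multilinear w.

Lemma multilinearD s1 s2 Z W :
  w (s1 ++ (Z + W) :: s2) = w (s1 ++ Z :: s2) + w (s1 ++ W :: s2).
Proof. by have := wL s1 s2 1 Z W; rewrite scale1r mul1r. Qed.

Lemma multilinear0 s1 s2 : w (s1 ++ 0 :: s2) = 0.
Proof.
have /eqP := multilinearD s1 s2 0 0.
by rewrite addr0 -subr_eq subrr => /eqP.
Qed.

Lemma multilinearZ s1 s2 f Z : w (s1 ++ f *: Z :: s2) = f * w (s1 ++ Z :: s2).
Proof. by have := wL s1 s2 f Z 0; rewrite addr0 multilinear0 addr0. Qed.

Lemma multilinearN s1 s2 Z : w (s1 ++ - Z :: s2) = - w (s1 ++ Z :: s2).
Proof. by rewrite -scaleN1r multilinearZ mulN1r. Qed.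

(** Polarization: expand [w] with [Z + W] in both adjacent slots. *)
Lemma multilinear_swap : alternating w -> forall s1 s2 Z W,
  w (s1 ++ Z :: W :: s2) = - w (s1 ++ W :: Z :: s2).
Proof.
move=> wA s1 s2 Z W; apply/eqP; rewrite -addr_eq0; apply/eqP.
have := wA s1 s2 (Z + W); rewrite multilinearD.
have E X : w (s1 ++ X :: (Z + W) :: s2) =
    w (s1 ++ X :: Z :: s2) + w (s1 ++ X :: W :: s2).
  by have := multilinearD (rcons s1 X) s2 Z W; rewrite !cat_rcons.
by rewrite !E !wA add0r addr0.
Qed.

End Multilinear.

(** Adjacent repetitions suffice: swaps move the first copy of [Z] past the arguments in between,
    one at a time. *)
Lemma is_formP w : is_form w <-> multilinear w /\ alternating w.
Proof.
split=> [[wL wA]|[wL wA]]; split=> //; first by move=> s1 s2 Z; exact: (wA s1 [::]).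
move=> s1 s2 s3 Z; elim: s2 s1 => [|W s2 IH] s1; first exact: wA.
rewrite /= multilinear_swap // -cat_rcons IH; exact: oppr0.
Qed.

Section FormHead.
Variable w : dform M.
Hypothesis wF : is_form w.
Let wL : multilinear w. Proof. by case: wF. Qed.

Lemma form_consZD f Z W s : w ((f *: Z + W) :: s) = f * w (Z :: s) + w (W :: s).
Proof. exact: (wL [::]). Qed.
Lemma form_consD Z W s : w ((Z + W) :: s) = w (Z :: s) + w (W :: s).
Proof. exact: (multilinearD wL [::]). Qed.
Lemma form_cons0 s : w (0 :: s) = 0.
Proof. exact: (multilinear0 wL [::]). Qed.
Lemma form_consZ f Z s : w (f *: Z :: s) = f * w (Z :: s).
Proof. exact: (multilinearZ wL [::]). Qed.
Lemma form_consN Z s : w (- Z :: s) = - w (Z :: s).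
Proof. exact: (multilinearN wL [::]). Qed.
Lemma form_alt Z s : w (Z :: Z :: s) = 0.
Proof. by case: wF => _ wA; exact: (wA [::] [::]). Qed.
Lemma form_swap Z W s : w (Z :: W :: s) = - w (W :: Z :: s).
Proof. by case/is_formP: wF => _ wA; exact: (multilinear_swap wL wA [::]). Qed.

End FormHead.

Lemma form_contr Z w : is_form w -> is_form (contr Z w).
Proof.
by case=> wL wA; split=> [s1|s1]; [exact: (wL (Z :: s1))|exact: (wA (Z :: s1))].
Qed.

Lemma form_zero : is_form (0 : dform M).
Proof. by split=> [s1 s2 f Z W|//]; rewrite !dformE mulr0 addr0. Qed.

Lemma formwD u v : is_form u -> is_form v -> is_form (u + v).
Proof.
move=> [uL uA] [vL vA]; split=> [s1 s2 f Z W|s1 s2 s3 Z].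
  by rewrite !dformE uL vL; ring.
by rewrite !dformE uA vA addr0.
Qed.

Lemma formwN u : is_form u -> is_form (- u).
Proof.
move=> [uL uA]; split=> [s1 s2 f Z W|s1 s2 s3 Z].
  by rewrite !dformE uL; ring.
by rewrite !dformE uA oppr0.
Qed.

Lemma form_bar w : is_form w -> is_form (bar w).
Proof.
move=> [wL wA]; split=> [s1 s2 f Z W|s1 s2 s3 Z]; rewrite /bar ?wA ?mulr0 //.
by rewrite wL !size_cat /=; ring.
Qed.

Lemma contr_bar Z w : contr Z (bar w) = - bar (contr Z w).
Proof. by apply/funext => s; rewrite /contr /bar /= exprS -mulrA mulN1r. Qed.

Lemma barD u v : bar (u + v) = bar u + bar v.
Proof. by apply/funext => s; rewrite /bar -mulrDr. Qed.

Lemma bar0 : bar 0 = 0.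
Proof. by apply/funext => s; exact: mulr0. Qed.

Lemma barK : involutive bar.
Proof. by move=> w; apply/funext => s; rewrite /bar mulrA -expr2 sqrr_sign mul1r. Qed.

(** * The wedge product by recursion on the list of arguments *)

Lemma sum_tuple_cons (k : nat) (F : bitseq -> A) :
  \sum_(m : k.+1.-tuple bool) F m =
  \sum_(m : k.-tuple bool) F (true :: m) +
  \sum_(m : k.-tuple bool) F (false :: m).
Proof.
pose h (x : bool * k.-tuple bool) := [tuple of x.1 :: x.2].
have hB : bijective h.
  exists (fun m : k.+1.-tuple bool => (thead m, [tuple of behead m])).
    by move=> [e m]; congr (_, _); apply: val_inj.
  by move=> m; rewrite [RHS](tuple_eta m).
rewrite (reindex h) /=; last exact: onW_bij.
rewrite -(pair_bigA _ (fun e (m : k.-tuple bool) => F (e :: m))) /=.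
by rewrite big_bool.
Qed.

(** A leading [false] forms an inversion with each later [true]; a leading [true] is the second
    entry of no inversion. *)
Lemma inversions_cons e (m : bitseq) :
  inversions (e :: m) = (inversions m + ~~ e * count id m)%N.
Proof.
rewrite /inversions /= big_ord_recl big_ord0 add0n.
have -> : count id m = (\sum_(j < size m) nth false m j)%N.
  by rewrite -sumn_count sumnE big_map (big_nth false) big_mkord.
rewrite big_distrr /= -big_split; apply: eq_bigr => j _ /=.
rewrite big_ord_recl /= addnC; congr addn.
by rewrite mulnb.
Qed.

Lemma wedge_nil a b : wedge a b [::] = a [::] * b [::].
Proof.
rewrite /wedge (big_pred1 [tuple]) => [|m]; last by rewrite [m]tuple0; apply/esym/eqP.
by rewrite /inversions big_ord0 mul1r.
Qed.

(** Contraction is an antiderivation. The masks split by their first bit; when it is [false], the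
    new inversions are as many as the arguments given to [a], which is the sign in [bar a]. *)
Lemma wedge_cons a b Z s :
  wedge a b (Z :: s) =
  wedge (contr Z a) b s + wedge (bar a) (contr Z b) s.
Proof.
rewrite {1}/wedge (sum_tuple_cons _ (fun m => (-1) ^+ inversions m *
  a (mask m (Z :: s)) * b (mask (map negb m) (Z :: s)))).
congr (_ + _); apply: eq_bigr => m _ /=.
  by rewrite inversions_cons mul0n addn0.
rewrite inversions_cons mul1n exprD /bar size_mask ?size_tuple //.
by rewrite -!mulrA.
Qed.

Lemma wedgeDl u v w : wedge (u + v) w = wedge u w + wedge v w.
Proof.
apply/funext => s; rewrite daddE.
rewrite -big_split; apply: eq_bigr => m _ /=.
by rewrite !daddE; ring.
Qed.

Lemma wedgeDr u v w : wedge u (v + w) = wedge u v + wedge u w.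
Proof.
apply/funext => s; rewrite daddE.
rewrite -big_split; apply: eq_bigr => m _ /=.
by rewrite !daddE; ring.
Qed.

Lemma wedge0l u : wedge 0 u = 0.
Proof.
by have /eqP := wedgeDl 0 0 u; rewrite addr0 -subr_eq subrr => /eqP.
Qed.

Lemma wedge0r u : wedge u 0 = 0.
Proof.
by have /eqP := wedgeDr u 0 0; rewrite addr0 -subr_eq subrr => /eqP.
Qed.

Lemma wedgeNl u v : wedge (- u) v = - wedge u v.
Proof. by apply/eqP; rewrite -addr_eq0 -wedgeDl addNr wedge0l. Qed.

Lemma wedgeNr u v : wedge u (- v) = - wedge u v.
Proof. by apply/eqP; rewrite -addr_eq0 -wedgeDr addNr wedge0r. Qed.

Lemma contr_wedge Z a b :
  contr Z (wedge a b) = wedge (contr Z a) b + wedge (bar a) (contr Z b).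
Proof. by apply/funext => s; exact: wedge_cons. Qed.

Lemma bar_wedge a b : bar (wedge a b) = wedge (bar a) (bar b).
Proof.
apply/funext => s; elim: s a b => [|Z s IH] a b.
  by rewrite /bar !wedge_nil !mul1r.
rewrite wedge_cons !contr_bar wedgeNl wedgeNr !doppE.
by rewrite -!IH /bar wedge_cons /= exprS; ring.
Qed.

Lemma wedgeA a b c : wedge a (wedge b c) = wedge (wedge a b) c.
Proof.
apply/funext => s; elim: s a b c => [|Z s IH] a b c.
  by rewrite !wedge_nil mulrA.
rewrite !wedge_cons !contr_wedge wedgeDl wedgeDr bar_wedge.
by rewrite !daddE addrA !IH.
Qed.

Lemma form_wedge a b : is_form a -> is_form b -> is_form (wedge a b).
Proof.
move=> aF bF; apply/is_formP; split=> s1 s2.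
  move=> f Z W; elim: s1 a b aF bF => [|X s1 IH] a b aF bF; last first.
    rewrite /= !wedge_cons !IH; first ring;
      by [|exact: form_contr|exact: form_bar].
  rewrite /= !wedge_cons /wedge mulrDr !mulr_sumr -!big_split /=.
  apply: eq_bigr => m _; rewrite /contr !form_consZD //; ring.
move=> Z; elim: s1 a b aF bF => [|X s1 IH] a b aF bF; last first.
  by rewrite /= !wedge_cons !IH ?addr0 //; [exact: form_bar|exact: form_contr..].
(* Of the four terms, the two mixed ones are opposite because contraction anticommutes with [bar];
   the other two contain a double contraction with [Z]. *)
rewrite /= !wedge_cons !contr_bar barK wedgeNl.
have E w : is_form w -> contr Z (contr Z w) = 0.
  by move=> wF; apply/funext => s; exact: form_alt.
rewrite !E // wedge0l wedge0r !dformE add0r addr0.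
by rewrite addrN.
Qed.

End FormTheory.

(** * Exterior derivative *)

Section ExteriorDerivative.
Context (R : realType) (n : nat) (M : manifold R n).
Local Notation A := (cinf M).
Local Notation T := (vfield M).
Implicit Types (X Y Z W : T) (f g : A) (s : seq T) (u v w a b c : dform M).

Lemma contr_scale Z f w :
  contr Z (fun t => f * w t) = (fun t => f * contr Z w t).
Proof. by []. Qed.

Lemma contrD Z u v : contr Z (u + v) = contr Z u + contr Z v.
Proof. by []. Qed.

Lemma contrN Z u : contr Z (- u) = - contr Z u.
Proof. by []. Qed.

(** The Lie derivative, computed by the commutation rule i_W L_Z = L_Z i_W - i_[Z,W] until no
    argument is left. *)
Fixpoint lie_rec s Z w : A :=
  if s is W :: s' then lie_rec s' Z (contr W w) - w (lie Z W :: s')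
  else Z (w [::]).

Definition lied Z w : dform M := fun s => lie_rec s Z w.
Arguments lied : simpl never.

(* [df /\ w], with the factor of degree one unfolded. *)
Fixpoint dwedge_rec s f w : A :=
  if s is W :: s' then W f * w s' - dwedge_rec s' f (contr W w) else 0.

Lemma lied_cons Z w W s :
  lied Z w (W :: s) = lied Z (contr W w) s - w (lie Z W :: s).
Proof. by []. Qed.

Lemma contr_lied Z W w :
  contr W (lied Z w) = lied Z (contr W w) - contr (lie Z W) w.
Proof. by []. Qed.

Lemma liedD Z u v : lied Z (u + v) = lied Z u + lied Z v.
Proof.
apply/funext => s; elim: s u v => [|W s IH] u v.
  by rewrite /lied /= !daddE vfieldD.
rewrite daddE !lied_cons contrD IH !daddE; ring.
Qed.

Lemma liedN Z u : lied Z (- u) = - lied Z u.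
Proof.
apply/funext => s; elim: s u => [|W s IH] u.
  by rewrite /lied /= doppE vfieldN.
rewrite doppE !lied_cons contrN IH !doppE; ring.
Qed.

Lemma lied0 Z : lied Z (0 : dform M) = 0.
Proof. by have /eqP := liedD Z 0 0; rewrite addr0 -subr_eq subrr => /eqP. Qed.

Lemma lied_scale Z f w s :
  lied Z (fun t => f * w t) s = f * lied Z w s + Z f * w s.
Proof.
elim: s w => [|W s IH] w; first by rewrite /lied /= vfieldM addrC.
by rewrite !lied_cons contr_scale IH /contr; ring.
Qed.

Lemma form_lied Z w : is_form w -> is_form (lied Z w).
Proof.
move=> wF; apply/is_formP; split=> s1 s2.
  move=> f X Y; elim: s1 w wF => [|W s1 IH] w wF; last first.
    rewrite /= !lied_cons IH; last exact: form_contr.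
    by case: wF => wL _; rewrite !(wL (_ :: s1)); ring.
  rewrite /= !lied_cons lieZDr !form_consZD //.
  rewrite (_ : contr _ w = (fun t => f * contr X w t) + contr Y w).
    by rewrite liedD daddE lied_scale /contr; ring.
  by apply/funext => s; rewrite /contr form_consZD.
move=> X; elim: s1 w wF => [|W s1 IH] w wF; last first.
  rewrite /= lied_cons IH; last exact: form_contr.
  by case/is_formP: wF => _ wA; rewrite (wA (_ :: s1)) subr0.
rewrite /= !lied_cons /contr (_ : (fun _ => _) = 0).
  by rewrite lied0 (form_swap wF (lie Z X)) dzeroE; ring.
by apply/funext => s; exact: form_alt.
Qed.

(** On functions this is the definition of the bracket; the inductive step is the Jacobi
    identity. *)
Lemma lied_lie X Y w : is_form w ->
  lied (lie X Y) w = lied X (lied Y w) - lied Y (lied X w).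
Proof.
move=> wF; apply/funext => s; elim: s w wF => [|W s IH] w wF; first by [].
have cF := form_contr W wF.
rewrite !dformE !lied_cons !contr_lied !(liedD, liedN) IH // !dformE.
rewrite lie_jacobi form_consD // form_consN //; ring.
Qed.

Lemma lied_bar Z w : lied Z (bar w) = bar (lied Z w).
Proof.
apply/funext => s; elim: s w => [|W s IH] w.
  by rewrite /lied /bar /= !mul1r.
rewrite lied_cons contr_bar liedN doppE IH /bar lied_cons /= exprS; ring.
Qed.

Lemma lied_wedge Z a b :
  lied Z (wedge a b) = wedge (lied Z a) b + wedge a (lied Z b).
Proof.
apply/funext => s; elim: s a b => [|W s IH] a b.
  by rewrite daddE /lied /= !wedge_nil vfieldM.
rewrite lied_cons contr_wedge liedD daddE !IH !daddE !wedge_cons.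
rewrite !contr_lied !(wedgeDl, wedgeDr, wedgeNl, wedgeNr) lied_bar !dformE; ring.
Qed.

(** * From Koszul's formula to Cartan's formula *)

Lemma omit0 Z s : omit 0 (Z :: s) = s.
Proof. exact: drop0. Qed.

Lemma omit_cons i Z s : omit i.+1 (Z :: s) = Z :: omit i s.
Proof. by []. Qed.

(** Unrolls the recursion into the shape of the sums in [dext]; moving the j-th bracket to the front
    costs the sign (-1)^j. *)
Lemma lied_koszul Z w s : is_form w ->
  lied Z w s = Z (w s) -
    \sum_(j < size s) (-1) ^+ j * w (lie Z (nth 0 s j) :: omit j s).
Proof.
elim: s w => [|W s IH] w wF; first by rewrite big_ord0 subr0.
rewrite lied_cons IH; last exact: form_contr.
rewrite /= big_ord_recl /= omit0 mul1r.
rewrite [X in _ = _ - (_ + X)](_ : _ =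
    \sum_(j < size s) (-1) ^+ j * contr W w (lie Z (nth 0 s j) :: omit j s)).
  by rewrite /contr; ring.
apply: eq_bigr => j _; rewrite /bump /= add1n exprS /contr.
by rewrite omit_cons form_swap //; ring.
Qed.

Lemma dext_nil w : dext w [::] = 0.
Proof. by rewrite /dext !big_ord0 addr0. Qed.

(* Cartan's formula *)
Lemma dext_cons w Z s : is_form w ->
  dext w (Z :: s) = lied Z w s - dext (contr Z w) s.
Proof.
move=> wF; rewrite lied_koszul // /dext /= !big_ord_recl big_ord0 add0r.
rewrite omit0 mul1r.
(* Deleting a later argument keeps [Z] in front; the sign comes from the shift of the index. *)
rewrite (_ : \sum_(i < size s) _ = - \sum_(i < size s)
    (-1) ^+ i * (nth 0 s i) (contr Z w (omit i s))); last first.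
  rewrite -sumrN; apply: eq_bigr => i _.
  by rewrite lift0 exprS mulN1r mulNr.
(* The pairs with first index 0 give the brackets of the Lie derivative. In the other pairs the two
   index shifts cancel, and the sign comes from swapping the bracket with [Z]. *)
rewrite (_ : \sum_(j < size s) \sum_(i < lift ord0 j) _ =
    - \sum_(j < size s) (-1) ^+ j * w (lie Z (nth 0 s j) :: omit j s) -
    \sum_(j < size s) \sum_(i < j) (-1) ^+ (i + j) *
      contr Z w (lie (nth 0 s i) (nth 0 s j) :: omit i (omit j s))).
  ring.
rewrite -!sumrN -big_split; apply: eq_bigr => j _.
rewrite lift0 big_ord_recl add0n exprS; congr (_ + _).
  by rewrite omit_cons omit0 mulN1r mulNr.
rewrite -sumrN; apply: eq_bigr => i _.
rewrite !lift0 addSn addnS !exprS /contr.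
by rewrite !omit_cons form_swap //; ring.
Qed.

Lemma dextD u v : dext (u + v) = dext u + dext v.
Proof.
apply/funext => s; rewrite daddE /dext addrACA; congr (_ + _).
  by rewrite -big_split; apply: eq_bigr => i _; rewrite /= daddE vfieldD mulrDr.
rewrite -big_split; apply: eq_bigr => j _; rewrite -big_split.
by apply: eq_bigr => i _; rewrite /= daddE mulrDr.
Qed.

Lemma dext0 : dext (0 : dform M) = 0.
Proof. by have /eqP := dextD 0 0; rewrite addr0 -subr_eq subrr => /eqP. Qed.

Lemma dextN u : dext (- u) = - dext u.
Proof. by apply/eqP; rewrite -addr_eq0 -dextD addNr dext0. Qed.

Lemma contr_dext Z w : is_form w ->
  contr Z (dext w) = lied Z w - dext (contr Z w).
Proof. by move=> wF; apply/funext => s; exact: dext_cons. Qed.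

Lemma dwedge_recN s f w : dwedge_rec s f (- w) = - dwedge_rec s f w.
Proof.
by elim: s w => [|W s IH] w /=; [rewrite oppr0|rewrite contrN IH doppE; ring].
Qed.

Lemma contr_swap X Y w : is_form w ->
  contr X (contr Y w) = - contr Y (contr X w).
Proof. by move=> wF; apply/funext => s; exact: form_swap. Qed.

Lemma contr_alt X w : is_form w -> contr X (contr X w) = 0.
Proof. by move=> wF; apply/funext => s; exact: form_alt. Qed.

(** The rule L_(fX) w = f L_X w + df /\ i_X w. Its last term is the obstruction to linearity in the
    field, to be cancelled in [form_dext]. *)
Lemma lied_scalel f X Y w s : is_form w ->
  lied (f *: X + Y) w s =
  f * lied X w s + lied Y w s + dwedge_rec s f (contr X w).
Proof.
elim: s w => [|W s IH] w wF; first by rewrite /lied /= addr0.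
rewrite !lied_cons IH /=; last exact: form_contr.
rewrite (contr_swap X) // dwedge_recN lieC lieZDr -scaleN1r.
rewrite form_consZ // !form_consZD // (lieC X) (lieC Y) !form_consN // /contr.
ring.
Qed.

Lemma form_scale f w : is_form w -> is_form (fun s => f * w s).
Proof.
move=> [wL wA]; split=> [s1 s2 g Z W|s1 s2 s3 Z]; rewrite ?wA ?mulr0 //.
by rewrite wL; ring.
Qed.

Lemma dext_scale f w s : is_form w ->
  dext (fun t => f * w t) s = f * dext w s + dwedge_rec s f w.
Proof.
elim: s w => [|W s IH] w wF; first by rewrite !dext_nil mulr0 addr0.
rewrite !dext_cons ?lied_scale ?contr_scale ?IH //=; first ring.
  exact: form_contr.
exact: form_scale.
Qed.

(** In Cartan's formula the df-terms of [lied_scalel] and [dext_scale] cancel, which gives linearity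
    in the first argument; contraction passes this on to the later ones. *)
Lemma form_dext w : is_form w -> is_form (dext w).
Proof.
move=> wF; apply/is_formP; split=> s1 s2.
  move=> f X Y; elim: s1 w wF => [|W s1 IH] w wF; last first.
    rewrite /= !dext_cons // IH; last exact: form_contr.
    by have [lL _] := form_lied W wF; rewrite lL; ring.
  rewrite /= !dext_cons // lied_scalel //.
  rewrite (_ : contr (f *: X + Y) w = (fun t => f * contr X w t) + contr Y w).
    by rewrite dextD daddE dext_scale; [ring|exact: form_contr].
  by apply/funext => s; rewrite /contr form_consZD.
move=> X; elim: s1 w wF => [|W s1 IH] w wF; last first.
  rewrite /= dext_cons // IH; last exact: form_contr.
  by have /is_formP[_ lA] := form_lied W wF; rewrite lA subr0.
rewrite /= !dext_cons ?lied_cons ?liexx; [|exact: form_contr|by []].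
by rewrite contr_alt // dext0 form_cons0 // dzeroE; ring.
Qed.

(** Contract both sides with [W]: by Cartan's formula and [lied_lie], the difference reduces to the
    same claim for [contr W w]. *)
Lemma dext_lied Z w : is_form w -> dext (lied Z w) = lied Z (dext w).
Proof.
move=> wF; apply/funext => s; elim: s w wF => [|W s IH] w wF.
  by rewrite dext_nil /lied /= dext_nil vfield0.
have cF := form_contr W wF.
rewrite dext_cons; last exact: form_lied.
rewrite lied_cons contr_lied contr_dext // dext_cons //.
rewrite dextD dextN liedD liedN !dformE IH // lied_lie // !dformE.
by ring.
Qed.

(** Applying Cartan's formula twice gives i_Z d d = L_Z d - d L_Z + d d i_Z, where the first two
    terms cancel and the third vanishes by induction. *)
Lemma dext_dext w : is_form w -> dext (dext w) = 0.
Proof.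
move=> wF; apply/funext => s; elim: s w wF => [|W s IH] w wF.
  exact: dext_nil.
rewrite dext_cons; last exact: form_dext.
rewrite contr_dext // dextD dextN dext_lied // !dformE IH //; last exact: form_contr.
by rewrite dzeroE; ring.
Qed.

Lemma dext_bar w : is_form w -> dext (bar w) = - bar (dext w).
Proof.
move=> wF; apply/funext => s; elim: s w wF => [|W s IH] w wF.
  by rewrite doppE /bar !dext_nil mulr0 oppr0.
rewrite dext_cons; last exact: form_bar.
rewrite contr_bar dextN lied_bar doppE IH; last exact: form_contr.
by rewrite !doppE /bar /= dext_cons // exprS; ring.
Qed.

Lemma dext_wedge a b : is_form a -> is_form b ->
  dext (wedge a b) = wedge (dext a) b + wedge (bar a) (dext b).
Proof.
move=> aF bF; apply/funext => s.
elim: s a b aF bF => [|W s IH] a b aF bF.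
  by rewrite daddE dext_nil !wedge_nil !dext_nil mulr0 mul0r addr0.
rewrite dext_cons; last exact: form_wedge.
have caF := form_contr W aF; have cbF := form_contr W bF; have baF := form_bar aF.
rewrite contr_wedge lied_wedge !daddE dextD daddE !IH // !daddE !wedge_cons.
rewrite !contr_dext // contr_bar dext_bar // barK.
rewrite !(wedgeDl, wedgeDr, wedgeNl, wedgeNr) !dformE; ring.
Qed.

End ExteriorDerivative.

(** * Twisted exterior derivatives *)

Section Pullback.
Context (R : realType) (n : nat) (M : manifold R n).
Local Notation A := (cinf M).
Local Notation T := (vfield M).
Implicit Types (X Y Z W : T) (f g : A) (s : seq T) (u v w a b c : dform M).
Implicit Types (F G P Q rho sigma : T -> T).

Definition vlinear F := forall f Z W, F (f *: Z + W) = f *: F Z + F W.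

Section Vlinear.
Variable F : T -> T.
Hypothesis FL : vlinear F.
Lemma vlinearD Z W : F (Z + W) = F Z + F W.
Proof. by have := FL 1 Z W; rewrite !scale1r. Qed.
Lemma vlinear0 : F 0 = 0.
Proof. by have /eqP := vlinearD 0 0; rewrite addr0 -subr_eq subrr => /eqP. Qed.
Lemma vlinearZ f Z : F (f *: Z) = f *: F Z.
Proof. by have := FL f Z 0; rewrite vlinear0 !addr0. Qed.
Lemma vlinearN Z : F (- Z) = - F Z.
Proof. by rewrite -scaleN1r vlinearZ scaleN1r. Qed.
Lemma vlinearB Z W : F (Z - W) = F Z - F W.
Proof. by rewrite vlinearD vlinearN. Qed.
End Vlinear.

Lemma form_pullback F w : vlinear F -> is_form w -> is_form (pullback F w).
Proof.
move=> FL [wL wA]; split=> [s1 s2 f Z W|s1 s2 s3 Z].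
  by rewrite /pullback !map_cat /= FL wL.
by rewrite /pullback map_cat /= map_cat wA.
Qed.

Lemma pullback_comp F G w : pullback F (pullback G w) = pullback (G \o F) w.
Proof. by apply/funext => s; rewrite /pullback -map_comp. Qed.

Lemma pullback_bar F w : pullback F (bar w) = bar (pullback F w).
Proof. by apply/funext => s; rewrite /pullback /bar size_map. Qed.

Lemma contr_pullback F Z w :
  contr Z (pullback F w) = pullback F (contr (F Z) w).
Proof. by []. Qed.

Lemma pullback_wedge F a b :
  pullback F (wedge a b) = wedge (pullback F a) (pullback F b).
Proof.
apply/funext => s; elim: s a b => [|Z s IH] a b.
  by rewrite /pullback /= !wedge_nil.
rewrite wedge_cons !contr_pullback -pullback_bar -!IH.
exact: wedge_cons.
Qed.

Lemma map_omit F i s : omit i (map F s) = map F (omit i s).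
Proof. by rewrite /omit -map_take -map_drop map_cat. Qed.

Lemma pullback_dextE F w s : pullback F (dext w) s =
  \sum_(i < size s) (-1) ^+ i * (F (nth 0 s i)) (w (map F (omit i s))) +
  \sum_(j < size s) \sum_(i < j) (-1) ^+ (i + j) *
    w (lie (F (nth 0 s i)) (F (nth 0 s j)) :: map F (omit i (omit j s))).
Proof.
rewrite /pullback /dext size_map; congr (_ + _).
  by apply: eq_bigr => i _; rewrite (nth_map 0) // map_omit.
apply: eq_bigr => j _; apply: eq_bigr => i _.
by rewrite !(nth_map 0) ?(ltn_trans (ltn_ord i)) // !map_omit.
Qed.

(** After [pullback rho], Koszul's formula evaluates the form only on fields [rho X] and their
    brackets, all fixed by [Q]. *)
Lemma pullback_dext_id rho Q w :
  (forall X, Q (rho X) = rho X) ->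
  (forall X Y, Q (lie (rho X) (rho Y)) = lie (rho X) (rho Y)) ->
  pullback rho (dext (pullback Q w)) = pullback rho (dext w).
Proof.
move=> Qrho Qlie; have E s : map Q (map rho s) = map rho s.
  by rewrite -map_comp; apply: eq_map => X /=.
apply/funext => s; rewrite !pullback_dextE; congr (_ + _).
  by apply: eq_bigr => i _; rewrite /pullback E.
by apply: eq_bigr => j _; apply: eq_bigr => i _; rewrite /pullback /= Qlie E.
Qed.

(** Under the condition [twistable] below, this is the Lie algebroid differential of the range of
    [rho], transported to the range of [P]. *)
Definition twist rho sigma w := pullback rho (dext (pullback sigma w)).

(* [rho] maps the range of [P] isomorphically, with inverse [sigma], onto a
   subbundle of the tangent bundle that is closed under brackets. *)
Definition twistable P rho sigma := [/\ vlinear rho, vlinear sigma,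
  forall X, sigma (rho X) = P X, forall X, rho (P X) = rho X &
  forall X Y, rho (sigma (lie (rho X) (rho Y))) = lie (rho X) (rho Y)].

Lemma twistD rho sigma u v :
  twist rho sigma (u + v) = twist rho sigma u + twist rho sigma v.
Proof.
rewrite /twist [pullback sigma (u + v)]/(pullback sigma u + pullback sigma v).
by rewrite dextD.
Qed.

Lemma twist0 rho sigma : twist rho sigma 0 = 0.
Proof.
by have /eqP := twistD rho sigma 0 0; rewrite addr0 -subr_eq subrr => /eqP.
Qed.

Lemma twistN rho sigma u : twist rho sigma (- u) = - twist rho sigma u.
Proof. by apply/eqP; rewrite -addr_eq0 -twistD addNr twist0. Qed.

Section Twist.
Variables P rho sigma : T -> T.
Hypothesis rsP : twistable P rho sigma.

Lemma form_twist w : is_form w -> is_form (twist rho sigma w).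
Proof. by case: rsP => *; apply/form_pullback/form_dext/form_pullback. Qed.

Lemma twist_invariant w : pullback P (twist rho sigma w) = twist rho sigma w.
Proof.
case: rsP => _ _ _ rhoP _; rewrite /twist pullback_comp.
by apply/funext => s; rewrite /pullback; congr dext; apply: eq_map => X /=.
Qed.

(** The inner [rho \o sigma] fixes the fields [rho X] and their brackets, so it drops out by
    [pullback_dext_id] and d d = 0 remains. *)
Lemma twist_twist w : is_form w -> twist rho sigma (twist rho sigma w) = 0.
Proof.
case: rsP => rL sL srP rP rlie wF; rewrite /twist pullback_comp.
rewrite (@pullback_dext_id rho (rho \o sigma)) => [|X|X Y] /=; last exact: rlie.
  by rewrite dext_dext //; exact: form_pullback.
by rewrite srP rP.
Qed.

(** On [P]-invariant forms [pullback rho] undoes [pullback sigma], so the Leibniz rule of [dext]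
    carries over. *)
Lemma twist_wedge a b : is_form a -> is_form b ->
  pullback P a = a -> pullback P b = b -> twist rho sigma (wedge a b) =
  wedge (twist rho sigma a) b + wedge (bar a) (twist rho sigma b).
Proof.
case: rsP => rL sL srP rP rlie aF bF Pa Pb.
rewrite /twist pullback_wedge dext_wedge; [|exact: form_pullback..].
have E w : pullback P w = w -> pullback rho (pullback sigma w) = w.
  move=> {2}<-; rewrite pullback_comp; apply/funext => s.
  by rewrite /pullback; congr w; apply: eq_map => X /=.
rewrite [LHS]/(pullback rho _ + pullback rho _) !pullback_wedge pullback_bar.
by rewrite !E.
Qed.

Lemma twist_bar w : is_form w ->
  twist rho sigma (bar w) = - bar (twist rho sigma w).
Proof.
case: rsP => _ sL _ _ _ wF; rewrite /twist pullback_bar dext_bar.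
  by rewrite -pullback_bar.
exact: form_pullback.
Qed.

(** On [P]-invariant forms the operator depends only on the anchor [rho] and on the bracket
    [sigma (lie (rho X) (rho Y))], and it does so additively. Hence operators add when their anchors
    and brackets do. *)
Lemma twistE w s : (forall X, P (P X) = P X) -> pullback P w = w ->
  twist rho sigma w s =
  \sum_(i < size s) (-1) ^+ i * (rho (nth 0 s i)) (w (omit i s)) +
  \sum_(j < size s) \sum_(i < j) (-1) ^+ (i + j) *
    w (sigma (lie (rho (nth 0 s i)) (rho (nth 0 s j))) :: omit i (omit j s)).
Proof.
case: rsP => _ _ srP _ _ PP Pw; rewrite /twist pullback_dextE.
have E t : map sigma (map rho t) = map P t.
  by rewrite -map_comp; apply: eq_map => X /=.
congr (_ + _).
  apply: eq_bigr => i _; rewrite /pullback E.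
  by rewrite -[in RHS]Pw.
apply: eq_bigr => j _; apply: eq_bigr => i _; rewrite /pullback /= E.
congr (_ * _); rewrite -[in LHS]Pw -[in RHS]Pw /pullback /= -map_comp.
by congr (w (_ :: _)); apply: eq_map => X /=.
Qed.

End Twist.

Lemma twist_add P rho1 sigma1 rho2 sigma2 rho3 sigma3 w :
  (forall X, P (P X) = P X) -> twistable P rho1 sigma1 -> twistable P rho2 sigma2 ->
  twistable P rho3 sigma3 ->
  (forall X, rho3 X = rho1 X + rho2 X) ->
  (forall X Y, sigma3 (lie (rho3 X) (rho3 Y)) =
    sigma1 (lie (rho1 X) (rho1 Y)) + sigma2 (lie (rho2 X) (rho2 Y))) ->
  is_form w -> pullback P w = w ->
  twist rho3 sigma3 w = twist rho1 sigma1 w + twist rho2 sigma2 w.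
Proof.
move=> PP t1 t2 t3 rho3E lie3E wF Pw; apply/funext => s.
rewrite daddE (twistE t1) // (twistE t2) // (twistE t3) // addrACA.
congr (_ + _); rewrite -big_split; apply: eq_bigr => j _.
  by rewrite rho3E vaddE mulrDr.
rewrite -big_split; apply: eq_bigr => i _.
by rewrite lie3E form_consD // mulrDr.
Qed.

(** The third operator is the sum of the other two. All three square to zero, so expanding the
    square of the sum leaves just the two mixed terms. *)
Lemma twist_anticomm P rho1 sigma1 rho2 sigma2 rho3 sigma3 w :
  (forall X, P (P X) = P X) -> twistable P rho1 sigma1 -> twistable P rho2 sigma2 ->
  twistable P rho3 sigma3 ->
  (forall X, rho3 X = rho1 X + rho2 X) ->
  (forall X Y, sigma3 (lie (rho3 X) (rho3 Y)) =
    sigma1 (lie (rho1 X) (rho1 Y)) + sigma2 (lie (rho2 X) (rho2 Y))) ->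
  is_form w -> pullback P w = w ->
  twist rho1 sigma1 (twist rho2 sigma2 w) =
  - twist rho2 sigma2 (twist rho1 sigma1 w).
Proof.
move=> PP t1 t2 t3 rho3E lie3E wF Pw.
have E u : is_form u -> pullback P u = u ->
    twist rho3 sigma3 u = twist rho1 sigma1 u + twist rho2 sigma2 u.
  exact: twist_add.
have := twist_twist t3 wF; rewrite [X in twist _ _ X = 0]E // twistD.
have F1 := form_twist t1 wF; have F2 := form_twist t2 wF.
rewrite !E ?(twist_invariant t1) ?(twist_invariant t2) //.
rewrite (twist_twist t1) // (twist_twist t2) //.
by rewrite add0r addr0 => /eqP; rewrite addrC addr_eq0 => /eqP.
Qed.

End Pullback.

(** * Complex and hypercomplex structures *)

Section ComplexStructure.
Context (R : realType) (n : nat) (M : manifold R n).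
Local Notation A := (cinf M).
Local Notation T := (vfield M).
Local Notation h := (cconst M 2^-1).
Local Notation im := (cconst M 'i).
Implicit Types (X Y Z W : T) (f g : A) (s : seq T) (u v w a b c : dform M).

Lemma im_sq : im * im = -1.
Proof. by rewrite -cconstM -expr2 sqr_i cconstN cconst1. Qed.

Lemma half2 : h + h = 1.
Proof.
have n2 : 2 != 0 :> R[i] by rewrite pnatr_eq0.
rewrite -cconstD -cconst1; congr cconst; rewrite -mulr2n -[LHS]mulr_natr.
exact: (mulVf n2).
Qed.

Lemma vfield_cconst Z (c : R[i]) : Z (cconst M c) = 0.
Proof.
have Z1 : Z 1 = 0.
  by have /eqP := vfieldM Z 1 1; rewrite !mulr1 mul1r -subr_eq subrr => /eqP.
case: Z Z1 => Z /= /asboolP[ZL _] Z1; have := ZL c 1 0.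
by rewrite mulr1 addr0 Z1 mulr0 add0r => ->; have := ZL 1 0 0;
  rewrite cconst1 mul1r addr0 mul1r => /eqP; rewrite -subr_eq subrr => /eqP.
Qed.

Lemma lie_cconstr Z (c : R[i]) W : lie Z (cconst M c *: W) = cconst M c *: lie Z W.
Proof. by apply: vfield_ext => f; rewrite !vfieldE vfieldM vfield_cconst; ring. Qed.

Variable I : T -> T.
Hypothesis I_cs : complex_structure I.

Lemma cs_linear : vlinear I. Proof. by case: I_cs => -[]. Qed.
Lemma csK Z : I (I Z) = - Z. Proof. by case: I_cs => -[]. Qed.

(* The eigenvalue of I on the range of [part I e]. *)
Definition eig (e : bool) : A := if e then im else - im.

Lemma eig_sq e : eig e * eig e = -1.
Proof. by case: e; rewrite /= ?mulrNN im_sq. Qed.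

Lemma partE e Z : part I e Z = h *: (Z - eig e *: I Z).
Proof. by case: e; rewrite /part //= scaleNr opprK. Qed.

Lemma part_linear e : vlinear (part I e).
Proof.
move=> f Z W; apply: vfield_ext => g.
by rewrite !partE cs_linear !vfieldE; ring.
Qed.

Lemma part_eig e Z : I (part I e Z) = eig e *: part I e Z.
Proof.
rewrite partE (vlinearZ cs_linear) (vlinearB cs_linear) (vlinearZ cs_linear) csK.
apply: vfield_ext => g; rewrite !vfieldE.
rewrite (_ : eig e * (h * (Z g - eig e * I Z g)) =
  h * (eig e * Z g - eig e * eig e * I Z g)); last ring.
by rewrite eig_sq; ring.
Qed.

Lemma eig_part e Z : I Z = eig e *: Z -> part I e Z = Z.
Proof.
move=> IZ; rewrite partE IZ scalerA eig_sq scaleN1r opprK scalerDr -scalerDl.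
by rewrite half2 scale1r.
Qed.

Lemma part_id e Z : part I e (part I e Z) = part I e Z.
Proof. exact/eig_part/part_eig. Qed.

Lemma part_sum Z : part I true Z + part I false Z = Z.
Proof.
rewrite !partE -scalerDr scaleNr opprK addrACA addNr addr0.
by rewrite scalerDr -scalerDl half2 scale1r.
Qed.

Lemma part_neg e Z : part I e (part I (~~ e) Z) = 0.
Proof.
rewrite partE part_eig scalerA (_ : eig e * eig (~~ e) = 1).
  by rewrite scale1r subrr scaler0.
by case: e; rewrite /= ?mulrN ?mulNr im_sq opprK.
Qed.

(** Integrability makes the eigenbundles involutive: with L = [X,Y], the Nijenhuis tensor on
    eigenvectors is -2 L - 2 [eig e] I L. *)
Lemma eig_lie e X Y : I X = eig e *: X -> I Y = eig e *: Y ->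
  I (lie X Y) = eig e *: lie X Y.
Proof.
move=> IX IY.
have lieE_r Z W : lie Z (eig e *: W) = eig e *: lie Z W.
  by case: e {IX IY} => /=; rewrite ?scaleNr ?lieNr lie_cconstr.
have lieE_l Z W : lie (eig e *: Z) W = eig e *: lie Z W.
  by rewrite lieC lieE_r -scalerN -lieC.
have := I_cs.2 X Y; rewrite /nijenhuis IX IY !lieE_l !lieE_r.
rewrite !(vlinearZ cs_linear) scalerA eig_sq; move: (lie X Y) => L N0.
(* The factor [h * eig e] turns the vanishing of the tensor into I L - [eig e] L = 0, as the
   eigenvalue squares to -1. *)
apply: vfield_ext => f; have := congr1 (fun Z : T => h * eig e * Z f) N0.
rewrite !vfieldE mulr0; move: (I L f) (L f) => a l E.
apply/eqP; rewrite -subr_eq0; apply/eqP; rewrite -[RHS]E.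
rewrite [RHS](_ : _ = - (h + h) * (eig e * l) - (h + h) * (eig e * eig e) * a).
  by rewrite half2 eig_sq; ring.
by ring.
Qed.

Lemma part_lie e X Y :
  part I e (lie (part I e X) (part I e Y)) = lie (part I e X) (part I e Y).
Proof. by apply/eig_part/eig_lie; exact: part_eig. Qed.

End ComplexStructure.

(** * The three involutive bundles of a hypercomplex structure *)

Section Hypercomplex.
Context (R : realType) (n : nat) (M : manifold R n) (H : hypercomplex M).
Local Notation A := (cinf M).
Local Notation T := (vfield M).
Local Notation I := (cI H).
Local Notation J := (cJ H).
Local Notation h := (cconst M 2^-1).
Local Notation im := (cconst M 'i).
Local Notation P := (part I true).
Implicit Types (X Y Z W : T) (f g : A) (s : seq T) (u v w a b c : dform M).

Let IL : vlinear I. Proof. exact/cs_linear/cI_complex. Qed.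
Let JL : vlinear J. Proof. exact/cs_linear/cJ_complex. Qed.
Let PL : vlinear P. Proof. exact/part_linear/cI_complex. Qed.
Let IP X : I (P X) = im *: P X. Proof. exact: (part_eig (cI_complex H) true X). Qed.
Let PP X : P (P X) = P X. Proof. exact/part_id/cI_complex. Qed.
Let eigP X : I X = im *: X -> P X = X.
Proof. exact: (@eig_part _ _ _ _ true). Qed.
Let JJ X : J (J X) = - X. Proof. exact/csK/cJ_complex. Qed.

Lemma eig_cJ X e : I X = eig M e *: X -> I (J X) = eig M (~~ e) *: J X.
Proof.
move=> IX; rewrite cIJ IX (vlinearZ JL) -scaleNr.
by case: e {IX} => //=; rewrite opprK.
Qed.

Lemma part_cJ e X : part I e (J X) = J (part I (~~ e) X).
Proof.
rewrite !partE (vlinearZ JL) (vlinearB JL) (vlinearZ JL) cIJ.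
by congr (_ *: (_ + _)); rewrite scalerN -!scaleNr; case: e; rewrite /= ?opprK.
Qed.

Definition rhoJ X : T := - J (P X).
Definition rho_sum X : T := P X + rhoJ X.
(** As (1 + J)(1 - J) = 2, half of 1 + J inverts the map 1 - J. *)
Definition sigma_sum X : T := P (h *: (X + J X)).

Lemma rhoJ_eig X : I (rhoJ X) = eig M false *: rhoJ X.
Proof. by rewrite (vlinearN IL) (eig_cJ (e := true) (IP X)) scalerN. Qed.

(** The fields [rhoJ X] lie in the involutive (-i)-eigenbundle of [I], and [J] exchanges the two
    eigenbundles. *)
Lemma lie_rhoJ_eig X Y :
  I (J (lie (rhoJ X) (rhoJ Y))) = im *: J (lie (rhoJ X) (rhoJ Y)).
Proof.
apply: (eig_cJ (e := false)); apply: (eig_lie (cI_complex H)); exact: rhoJ_eig.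
Qed.

Lemma twistable_del : twistable P P id.
Proof. by split=> // X Y; exact/part_lie/cI_complex. Qed.

Lemma rhoJ_linear : vlinear rhoJ.
Proof. by move=> f X Y; rewrite /rhoJ PL JL opprD scalerN. Qed.

Lemma twistable_delJ : twistable P rhoJ J.
Proof.
split=> [|||X|X Y]; [exact: rhoJ_linear|exact: JL|..].
- by move=> X; rewrite /rhoJ (vlinearN JL) JJ opprK.
- by rewrite /rhoJ PP.
by rewrite /rhoJ -/(rhoJ X) -/(rhoJ Y) eigP ?lie_rhoJ_eig // JJ opprK.
Qed.

(** The sum of the two brackets that [del] and [delJ] induce on the range of [P]. *)
Definition lie_sum X Y : T := lie (P X) (P Y) + J (lie (rhoJ X) (rhoJ Y)).

Lemma lie_sumP X Y : P (lie_sum X Y) = lie_sum X Y.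
Proof.
rewrite /lie_sum (vlinearD PL) (part_lie (cI_complex H)).
by rewrite [P (J _)]eigP // lie_rhoJ_eig.
Qed.

(* This is the vanishing of the Nijenhuis tensor of [J]. *)
Lemma lie_rho_sum X Y :
  lie (rho_sum X) (rho_sum Y) = lie_sum X Y - J (lie_sum X Y).
Proof.
rewrite /lie_sum /rho_sum /rhoJ (vlinearD JL) JJ.
(* After expansion the claim is - [Z,JW] - [JZ,W] = J[JZ,JW] - J[Z,W], which is [J] applied to the
   vanishing Nijenhuis tensor. *)
move: (P X) (P Y) => Z W; have := congr1 J ((cJ_complex H).2 Z W).
rewrite /nijenhuis !(vlinearB JL) !JJ (vlinear0 JL) !opprK => N0.
rewrite !(lieDl, lieDr, lieNl, lieNr) !opprK; apply: vfield_ext => f.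
move: (congr1 (fun V : T => V f) N0); rewrite !(vaddE, voppE, vzeroE).
move: (lie (J Z) (J W)) (lie Z (J W)) (lie (J Z) W) (lie Z W) => L1 L2 L3 L4 E.
by rewrite -[RHS]subr0 -E; ring.
Qed.

Lemma sigma_sumK X : sigma_sum (X - J X) = P X.
Proof.
rewrite /sigma_sum (vlinearB JL) JJ opprK addrA subrK.
by rewrite scalerDr -scalerDl half2 scale1r.
Qed.

Lemma rho_sumE X : rho_sum X = P X - J (P X). Proof. by []. Qed.

(** Involutivity holds because [lie_sum X Y] is [P]-invariant: by [lie_rho_sum], the bracket is then
    [rho_sum] of it. *)
Lemma twistable_sum : twistable P rho_sum sigma_sum.
Proof.
split=> [f X Y|f X Y|X|X|X Y].
- by rewrite /rho_sum PL rhoJ_linear scalerDr addrACA.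
- rewrite /sigma_sum JL -PL; congr P.
  by apply: vfield_ext => g; rewrite !vfieldE; ring.
- by rewrite rho_sumE sigma_sumK PP.
- by rewrite !rho_sumE !PP.
by rewrite lie_rho_sum sigma_sumK rho_sumE PP lie_sumP.
Qed.

Lemma sigma_lie_sum X Y : sigma_sum (lie (rho_sum X) (rho_sum Y)) =
  lie (P X) (P Y) + J (lie (rhoJ X) (rhoJ Y)).
Proof. by rewrite lie_rho_sum sigma_sumK lie_sumP. Qed.

Lemma twist_del_delJ w : is_form w -> pullback P w = w ->
  twist P id (twist rhoJ J w) = - twist rhoJ J (twist P id w).
Proof.
exact: (twist_anticomm PP twistable_del twistable_delJ twistable_sum _
  sigma_lie_sum).
Qed.

End Hypercomplex.

(** * Dolbeault operators *)

Section Types.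
Context (R : realType) (n : nat) (M : manifold R n).
Local Notation A := (cinf M).
Local Notation T := (vfield M).
Implicit Types (X Y Z W : T) (f g : A) (s : seq T) (u v w a b c : dform M).
Variable I : T -> T.
Hypothesis I_cs : complex_structure I.

(* Forms of type [(p, 0)] if [e], of type [(0, p)] otherwise. *)
Definition pure (e : bool) (p : int) w := [/\ is_form w,
  pullback (part I e) w = w & forall s, (size s)%:Z != p -> w s = 0].

Lemma parts_cons e (m : bitseq) Z s :
  parts I (e :: m) (Z :: s) = part I e Z :: parts I m s.
Proof. by []. Qed.

Lemma parts_nseq e s : parts I (nseq (size s) e) s = map (part I e) s.
Proof. by elim: s => //= Z s IH; rewrite parts_cons IH. Qed.

Lemma form_parts w s : is_form w ->
  w s = \sum_(m : (size s).-tuple bool) w (parts I m s).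
Proof.
elim: s w => [|Z s IH] w wF.
  rewrite (big_pred1 [tuple]) // => m.
  by rewrite [m]tuple0; apply/esym/eqP.
rewrite (sum_tuple_cons _ (fun m => w (parts I m (Z :: s)))).
rewrite -{1}(part_sum I Z) form_consD //.
by congr (_ + _); rewrite -[LHS]/(contr _ w s) IH //; exact: form_contr.
Qed.

(** Some argument is a part of the opposite type, which [part I e] kills. *)
Lemma form_parts_neq e w (m : bitseq) s : is_form w -> size m = size s ->
  m != nseq (size s) e -> w (map (part I e) (parts I m s)) = 0.
Proof.
elim: m s w => [|e' m IH] [|Z s] w wF //= [sm].
have [->|ne] := eqVneq e' e.
  rewrite eqseq_cons eqxx /= => nm.
  exact: (IH _ (contr (part I e (part I e Z)) w) (form_contr _ wF)).
move=> _; have -> : e' = ~~ e by move: ne; case: (e) (e') => -[].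
by rewrite part_neg // form_cons0.
Qed.

Lemma pure_parts e p w (m : bitseq) s : pure e p w -> size m = size s ->
  w (parts I m s) = if m == nseq (size s) e then w s else 0.
Proof.
move=> [wF wP _] sm; have [->|ne] := eqVneq m.
  by rewrite parts_nseq -{2}wP.
by rewrite -wP; exact: form_parts_neq.
Qed.

Lemma has_type_nseq p q k e : has_type p q (nseq k e) =
  if e then (k%:Z == p) && (0 == q) else (0 == p) && (k%:Z == q).
Proof. by rewrite /has_type !count_nseq; case: e => /=; rewrite !mul1n !mul0n. Qed.

Lemma pure_type e (p : int) (m : bitseq) :
  has_type (if e then p else 0) (if e then 0 else p) m -> m = nseq (size m) e.
Proof.
move=> /andP[mt mf]; apply/all_pred1P.
suff : ~~ has (predC (pred1 e)) m by rewrite has_predC negbK.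
by rewrite has_count -leqNgt leqn0; case: e mt mf => [_|+ _];
  rewrite eqz_nat => /eqP <-; apply/eqP/eq_count => -[].
Qed.

Lemma sum_nseq e k (F : bitseq -> A) (p : pred bitseq) :
  (forall m, size m = k -> m != nseq k e -> p m -> F m = 0) ->
  \sum_(m : k.-tuple bool | p m) F m = if p (nseq k e) then F (nseq k e) else 0.
Proof.
move=> F0; rewrite big_mkcond (bigD1 [tuple of nseq k e]) //= big1 ?addr0 //.
by move=> m ne; case: ifP => // /F0; apply; rewrite ?size_tuple.
Qed.

Lemma proj_pure e p w (p' q' : int) : pure e p w ->
  proj I p' q' w =
  if (if e then (p' == p) && (q' == 0) else (p' == 0) && (q' == p)) then w else 0.
Proof.
move=> wp; apply/funext => s; rewrite /proj.
rewrite (@sum_nseq e _ (fun m => w (parts I m s)) (has_type p' q')); last first.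
  by move=> m sm /negPf ne _; rewrite (pure_parts wp sm) ne.
rewrite (pure_parts wp) ?size_nseq // eqxx has_type_nseq.
case: wp => _ _ w0; have [sp|sp] := eqVneq (size s)%:Z p; last first.
  by rewrite w0 // if_same; case: ifP => // _; rewrite w0.
rewrite -sp; case: e {w0} => /=; first rewrite eq_sym.
  by rewrite (eq_sym 0); case: ifP.
by rewrite (eq_sym 0) (eq_sym q'); case: ifP.
Qed.

Lemma proj_full e w s :
  proj I (if e then (size s)%:Z else 0) (if e then 0 else (size s)%:Z) w s =
  w (map (part I e) s).
Proof.
rewrite /proj (@sum_nseq e _ (fun m => w (parts I m s)) (has_type _ _))
  => [|m sm /eqP ne].
  by rewrite has_type_nseq parts_nseq; case: e; rewrite !eqxx.
by move/pure_type; rewrite sm.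
Qed.

Lemma size_omit i s : (i < size s)%N -> (size (omit i s)).+1 = size s.
Proof.
move=> si; rewrite /omit size_cat size_drop size_takel ?(ltnW si) //.
by rewrite -addnS -subSn // subSS subnKC // ltnW.
Qed.

Lemma dext_degree (p : int) w s : (forall t, (size t)%:Z != p -> w t = 0) ->
  (size s)%:Z != p + 1 -> dext w s = 0.
Proof.
move=> w0 sp.
have so t : (size t).+1 = size s -> w t = 0.
  by move=> ts; apply: w0; apply: contraNneq sp => <-; rewrite -ts -addn1 PoszD.
rewrite /dext !big1 ?addr0 // => [j _|i _].
  rewrite big1 // => i _; rewrite so ?mulr0 //= size_omit ?size_omit //.
  by rewrite -ltnS size_omit // (leq_trans _ (ltn_ord j)) // ltnS.
by rewrite so ?vfield0 ?mulr0 // size_omit.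
Qed.

(** Among the terms of [form_parts], the type condition leaves only the constant mask, and that one
    only in degree [p]. *)
Lemma pureP e (p : int) w : Apq I (if e then p else 0) (if e then 0 else p) w <->
  pure e p w.
Proof.
split=> [[wF w0]|wp].
  have E s : w s = if (size s)%:Z == p then w (map (part I e) s) else 0.
    rewrite (form_parts _ wF) (bigD1 [tuple of nseq (size s) e]) //=.
    rewrite parts_nseq big1 ?addr0 => [|m].
      case: ifPn => // sp; rewrite -parts_nseq w0 ?size_nseq //.
      by rewrite has_type_nseq; case: e {w0}; rewrite (negPf sp) ?andbF.
    rewrite -val_eqE /= => /eqP ne; apply: w0; first by rewrite size_tuple.
    by apply/negP => /pure_type; rewrite size_tuple.
  split=> // [|s /negPf sp]; last by rewrite E sp.
  apply/funext => s; rewrite /pullback E size_map [RHS]E -map_comp.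
  by case: ifP => // _; congr w; apply: eq_map => X /=; rewrite part_id.
have [wF _ w0] := wp; split=> // m s sm nt.
rewrite (pure_parts wp sm); case: ifP => // /eqP mE.
apply: w0; apply: contraNneq nt => sp.
by rewrite mE has_type_nseq sp; case: e {wp mE}; rewrite !eqxx.
Qed.

Lemma del_pure p w : pure true p w -> del I w = pullback (part I true) (dext w).
Proof.
move=> wp; apply/funext => s; rewrite /del /pullback.
(* A form of type (p,0) only meets the summand with [q] equal to 0, the last one; if the degree of
   [w] does not match, both sides vanish. *)
case: (lastP s) => [|t Z]; first by rewrite big_ord0 dext_nil.
rewrite size_rcons big_ord_recr /= subnn big1 ?add0r => [|i _]; last first.
  rewrite (proj_pure _ _ wp) /= eqz_nat subn_eq0 ltnS leqNgt ltn_ord andbF.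
  by rewrite dext0 /proj big1.
rewrite -(size_rcons t Z) (proj_full true) (proj_pure _ _ wp) andbT.
case: eqP => // tp; rewrite dext0; apply/esym.
have [_ _ w0] := wp; apply: (dext_degree w0); rewrite size_map size_rcons.
by rewrite -addn1 PoszD (inj_eq (addIr _)); apply/eqP.
Qed.

Lemma delbar_pure p w :
  pure false p w -> delbar I w = pullback (part I false) (dext w).
Proof.
move=> wp; apply/funext => s; rewrite /delbar /pullback.
(* Here the index p of the surviving summand is 0, so it is the first one. *)
case: s => [|Z t]; first by rewrite big_ord0 dext_nil.
rewrite /= big_ord_recl /= subn1 /= big1 ?addr0 => [|i _]; last first.
  by rewrite (proj_pure _ _ wp) /= dext0 /proj big1.
rewrite [LHS](proj_full false _ (Z :: t)) (proj_pure _ _ wp) /=.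
case: eqP => // tp; rewrite dext0; apply/esym.
have [_ _ w0] := wp; apply: (dext_degree w0); rewrite /= size_map.
by rewrite -addn1 PoszD (inj_eq (addIr _)); apply/eqP.
Qed.

End Types.

(** * The operators del and delJ on (p,0)-forms *)

Section Bidifferential.
Context (R : realType) (n : nat) (M : manifold R n) (H : hypercomplex M).
Local Notation A := (cinf M).
Local Notation T := (vfield M).
Local Notation I := (cI H).
Local Notation J := (cJ H).
Local Notation P := (part I true).
Implicit Types (X Y Z W : T) (f g : A) (s : seq T) (u v w a b c : dform M).
Implicit Types p q r : int.

Lemma Ap0P p w : Ap0 H p w <-> pure I true p w.
Proof. exact: (pureP (cI_complex H) true). Qed.

Lemma Ap0_form p w : Ap0 H p w -> is_form w. Proof. by case. Qed.

Lemma Ap0_inv p w : Ap0 H p w -> pullback P w = w.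
Proof. by case/Ap0P. Qed.

Lemma Ap0_degree p w s : Ap0 H p w -> (size s)%:Z != p -> w s = 0.
Proof. by case/Ap0P => _ _; apply. Qed.

Lemma Ap0_neg p w : p < 0 -> Ap0 H p w -> w = 0.
Proof.
move=> p0 /Ap0P[_ _ w0]; apply/funext => s; apply: w0.
by apply: contraTneq p0 => <-.
Qed.

Lemma Ap0_0 p : Ap0 H p 0.
Proof. by apply/Ap0P; split=> //; exact: form_zero. Qed.

Lemma Ap0D p u v : Ap0 H p u -> Ap0 H p v -> Ap0 H p (u + v).
Proof.
move=> /Ap0P[uF uP u0] /Ap0P[vF vP v0]; apply/Ap0P; split.
- exact: formwD.
- by rewrite -{2}uP -{2}vP.
- by move=> s sp; rewrite daddE u0 ?v0 ?addr0.
Qed.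

Lemma Ap0N p u : Ap0 H p u -> Ap0 H p (- u).
Proof.
move=> /Ap0P[uF uP u0]; apply/Ap0P; split; first exact: formwN.
  by rewrite -{2}uP.
by move=> s sp; rewrite doppE u0 ?oppr0.
Qed.

Lemma Ap0B p u v : Ap0 H p u -> Ap0 H p v -> Ap0 H p (u - v).
Proof. by move=> Au Av; apply: Ap0D (Ap0N _). Qed.

Lemma Ap0_bar p u : Ap0 H p u -> Ap0 H p (bar u).
Proof.
move=> /Ap0P[uF uP u0]; apply/Ap0P; split; first exact: form_bar.
  by rewrite pullback_bar uP.
by move=> s sp; rewrite /bar u0 ?mulr0.
Qed.

Lemma Ap0_wedge p q u v : Ap0 H p u -> Ap0 H q v -> Ap0 H (p + q) (wedge u v).
Proof.
move=> /Ap0P[uF uP u0] /Ap0P[vF vP v0]; apply/Ap0P; split.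
- exact: form_wedge.
- by rewrite pullback_wedge uP vP.
move=> s sp; rewrite /wedge big1 // => m _.
have sm : size m = size s by rewrite size_tuple.
have [up|up] := eqVneq (size (mask m s))%:Z p; last by rewrite u0 ?mulr0 ?mul0r.
rewrite v0 ?mulr0 //; apply: contraNneq sp => <-; rewrite -up -PoszD.
by rewrite !size_mask ?size_map // count_map count_predC sm.
Qed.

Lemma Ap0_twist rho sigma p w : twistable P rho sigma ->
  Ap0 H p w -> Ap0 H (p + 1) (twist rho sigma w).
Proof.
move=> rs /Ap0P[wF wP w0]; apply/Ap0P; split.
- exact: (form_twist rs).
- exact: (twist_invariant rs).
move=> s sp; rewrite /twist /pullback (dext_degree (p := p)) ?size_map //.
by move=> t tp; rewrite w0 // size_map.
Qed.

Lemma del_twist p w : Ap0 H p w -> del I w = twist P id w.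
Proof.
move/Ap0P/(del_pure (cI_complex H)) ->; rewrite /twist; congr (pullback _ (dext _)).
by apply/funext => s; rewrite /pullback map_id.
Qed.

(** Since [J] exchanges the types, [pullback (cJ H) w] is of type (0,p), where [delbar_pure]
    applies; the (0,1)-part of - J X is then [rhoJ H X]. *)
Lemma delJ_twist p w : Ap0 H p w -> delJ H w = twist (rhoJ H) J w.
Proof.
move=> /Ap0P[wF wP w0]; rewrite /delJ (delbar_pure (cI_complex H) (p := p)).
  rewrite pullback_comp; apply/funext => s; rewrite /pullback /twist /pullback.
  congr dext; apply: eq_map => X /=.
  by rewrite (vlinearN (part_linear (cI_complex H) _)) part_cJ.
split; first by apply: form_pullback wF; exact/cs_linear/cJ_complex.
  rewrite -{2}wP !pullback_comp; apply/funext => s; rewrite /pullback.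
  by congr w; apply: eq_map => X /=; rewrite part_cJ.
by move=> s sp; rewrite /pullback w0 // size_map.
Qed.

Local Notation d := (twist P id).
Local Notation dJ := (twist (rhoJ H) J).

Lemma ddJ_exact p x : ddJ_lemma H -> Ap0 H (p - 1) x -> dJ (d x) = 0 ->
  exists2 y, Ap0 H (p - 2) y & d x = d (dJ y).
Proof.
move=> L Ax x0; have Adx : Ap0 H p (d x).
  by have := Ap0_twist (twistable_del H) Ax; rewrite subrK.
(* [ddJ_lemma] speaks of natural degrees; in a negative degree all forms are zero and 0 serves as
   witness. *)
case: p Ax Adx => p Ax Adx; last first.
  exists 0; first exact: Ap0_0.
  by rewrite (Ap0_neg _ Adx) // !twist0.
have : ((del I \o delJ H) @` Ap0 H (p%:Z - 2)) (d x).
  rewrite -(L p).1; split; first by exists x => //; exact: del_twist Ax.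
  by split=> //=; rewrite (delJ_twist Adx).
case=> y Ay <-; exists y => //=.
rewrite (delJ_twist Ay); exact: del_twist (Ap0_twist (twistable_delJ H) Ay).
Qed.

Lemma ddJ_exactJ p x : ddJ_lemma H -> Ap0 H (p - 1) x -> d (dJ x) = 0 ->
  exists2 y, Ap0 H (p - 2) y & dJ x = d (dJ y).
Proof.
move=> L Ax x0; have Adx : Ap0 H p (dJ x).
  by have := Ap0_twist (twistable_delJ H) Ax; rewrite subrK.
case: p Ax Adx => p Ax Adx; last first.
  exists 0; first exact: Ap0_0.
  by rewrite (Ap0_neg _ Adx) // !twist0.
have : ((del I \o delJ H) @` Ap0 H (p%:Z - 2)) (dJ x).
  rewrite -(L p).2; split; first by exists x => //; exact: delJ_twist Ax.
  by split=> //=; rewrite (del_twist Adx).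
case=> y Ay <-; exists y => //=.
rewrite (delJ_twist Ay); exact: del_twist (Ap0_twist (twistable_delJ H) Ay).
Qed.

(** The form [dJ a] is [d]-closed by anticommutation, hence equal to some [d (dJ y)], that is, to
    [- dJ (d y)]. *)
Lemma delJ_closed_repr p a : ddJ_lemma H -> Ap0 H p a -> d a = 0 ->
  exists2 x, Ap0 H (p - 1) x & dJ (a + d x) = 0.
Proof.
move=> L Aa da0; have aF := Ap0_form Aa; have aP := Ap0_inv Aa.
have [] := @ddJ_exactJ (p + 1) a L; rewrite ?addrK //.
  by rewrite twist_del_delJ // da0 twist0 oppr0.
(* Reassociated, the degree [p + 1 - 2] is [p + (1 - 2)], which computes to [p - 1]. *)
move=> y; rewrite -addrA => Ay dJa; exists y => //.
by rewrite twistD dJa (twist_del_delJ (Ap0_form Ay) (Ap0_inv Ay)) addNr.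
Qed.

End Bidifferential.

(** * Massey products *)

Section Massey.
Context (R : realType) (n : nat) (M : manifold R n) (H : hypercomplex M).
Local Notation J := (cJ H).
Local Notation P := (part (cI H) true).
Local Notation d := (twist P id).
Local Notation dJ := (twist (rhoJ H) J).
Implicit Types (p q r : int) (u v w a b c : dform M).

Lemma d_wedge p q u v : Ap0 H p u -> Ap0 H q v ->
  d (wedge u v) = wedge (d u) v + wedge (bar u) (d v).
Proof.
move=> Au Av; apply: (twist_wedge (twistable_del H)).
- exact: Ap0_form Au.
- exact: Ap0_form Av.
- exact: Ap0_inv Au.
- exact: Ap0_inv Av.
Qed.

Lemma dJ_wedge p q u v : Ap0 H p u -> Ap0 H q v ->
  dJ (wedge u v) = wedge (dJ u) v + wedge (bar u) (dJ v).
Proof.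
move=> Au Av; apply: (twist_wedge (twistable_delJ H)).
- exact: Ap0_form Au.
- exact: Ap0_form Av.
- exact: Ap0_inv Au.
- exact: Ap0_inv Av.
Qed.

Lemma d_bar p u : Ap0 H p u -> d (bar u) = - bar (d u).
Proof. by move=> Au; exact: (twist_bar (twistable_del H) (Ap0_form Au)). Qed.

Lemma dd p u : Ap0 H p u -> d (d u) = 0.
Proof. by move=> Au; exact: (twist_twist (twistable_del H) (Ap0_form Au)). Qed.

Lemma Ap0_d p u : Ap0 H p u -> Ap0 H (p + 1) (d u).
Proof. exact: (Ap0_twist (twistable_del H)). Qed.

Lemma Ap0_dJ p u : Ap0 H p u -> Ap0 H (p + 1) (dJ u).
Proof. exact: (Ap0_twist (twistable_delJ H)). Qed.

Lemma closed_add_exact p a x : Ap0 H p a -> Ap0 H (p - 1) x -> d a = 0 ->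
  Ap0 H p (a + d x) /\ d (a + d x) = 0.
Proof.
move=> Aa Ax da; split; last by rewrite twistD da (dd Ax) addr0.
by apply: Ap0D Aa _; have := Ap0_d Ax; rewrite subrK.
Qed.

(** As [b'] is closed, [d x] times [b'] has the primitive [wedge x b'], and [a] times [d y] has the
    primitive [wedge (bar a) y]; this dictates [l'], and [m'] likewise. Between the two Massey
    cocycles the terms with [bar a], [y], [c'] cancel by associativity, and the rest is exact. *)
Lemma massey_change p q r a b c l m x y z :
  Ap0 H p a -> Ap0 H q b -> Ap0 H r c ->
  Ap0 H (p + q - 1) l -> Ap0 H (q + r - 1) m ->
  Ap0 H (p - 1) x -> Ap0 H (q - 1) y -> Ap0 H (r - 1) z ->
  d a = 0 -> d b = 0 -> d c = 0 ->
  wedge a b = d l -> wedge b c = d m ->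
  let a' := a + d x in let b' := b + d y in let c' := c + d z in
  let l' := l + wedge x b' + wedge (bar a) y in
  let m' := m + wedge y c' + wedge (bar b) z in
  [/\ d l' = wedge a' b', d m' = wedge b' c' &
    wedge l' c' - wedge (bar a') m' =
      wedge l c - wedge (bar a) m + d (wedge (bar l) z + wedge (bar x) m')].
Proof.
move=> Aa Ab Ac Al Am Ax Ay Az da db dc ab bc a' b' c' l' m'.
have [Ab' db'] : Ap0 H q b' /\ d b' = 0 by exact: closed_add_exact.
have [Ac' dc'] : Ap0 H r c' /\ d c' = 0 by exact: closed_add_exact.
have dl' : d l' = wedge a' b'.
  rewrite /l' !twistD (d_wedge Ax Ab') (d_wedge (Ap0_bar Aa) Ay).
  rewrite (d_bar Aa) da barK db' -ab bar0.
  rewrite oppr0 wedge0l wedge0r addr0 add0r addrAC -wedgeDr.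
  by rewrite -wedgeDl.
have dm' : d m' = wedge b' c'.
  rewrite /m' !twistD (d_wedge Ay Ac') (d_wedge (Ap0_bar Ab) Az).
  rewrite (d_bar Ab) db barK dc' -bc bar0.
  rewrite oppr0 wedge0l wedge0r addr0 add0r addrAC -wedgeDr.
  by rewrite -wedgeDl.
split=> //.
have Ay' : Ap0 H (q + r - 1) (wedge y c').
  by have := Ap0_wedge Ay Ac'; rewrite addrAC.
have Az' : Ap0 H (q + r - 1) (wedge (bar b) z).
  by have := Ap0_wedge (Ap0_bar Ab) Az; rewrite addrA.
have Am' : Ap0 H (q + r - 1) m' by do 2?apply: Ap0D.
rewrite twistD (d_wedge (Ap0_bar Al) Az) (d_wedge (Ap0_bar Ax) Am').
rewrite (d_bar Al) (d_bar Ax) !barK dm' -ab bar_wedge !wedgeNl.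
rewrite [wedge l' c']wedgeDl [wedge (l + _) c']wedgeDl [wedge l c']wedgeDr.
rewrite [bar a']barD [wedge (_ + _) m']wedgeDl [wedge (bar a) m']wedgeDr.
rewrite [wedge (bar a) (m + _)]wedgeDr !wedgeA.
by apply/funext => s; rewrite !dformE; ring.
Qed.

Lemma massey_exact p q r a b c : ddJ_lemma H ->
  Ap0 H p a -> Ap0 H q b -> Ap0 H r c ->
  d a = 0 -> d b = 0 -> d c = 0 -> dJ a = 0 -> dJ b = 0 -> dJ c = 0 ->
  (exists2 l, Ap0 H (p + q - 1) l & d l = wedge a b) ->
  (exists2 m, Ap0 H (q + r - 1) m & d m = wedge b c) ->
  exists l m t, [/\ Ap0 H (p + q - 1) l, Ap0 H (q + r - 1) m,
    Ap0 H (p + q + r - 2) t, d l = wedge a b & d m = wedge b c /\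
    wedge l c - wedge (bar a) m = d t].
Proof.
move=> L Aa Ab Ac da db dc dJa dJb dJc [l0 Al0 dl0] [m0 Am0 dm0].
(* By the Leibniz rule the product is [dJ]-closed; being [d]-exact, it has a primitive of the form
   [dJ l]. *)
have [||l Al El] := @ddJ_exact _ _ _ H (p + q) l0 L => //.
  by rewrite dl0 (dJ_wedge Aa Ab) dJa dJb wedge0l wedge0r addr0.
have [||m Am Em] := @ddJ_exact _ _ _ H (q + r) m0 L => //.
  by rewrite dm0 (dJ_wedge Ab Ac) dJb dJc wedge0l wedge0r addr0.
have AJl : Ap0 H (p + q - 1) (dJ l).
  by have := Ap0_dJ Al; rewrite -addrA.
have AJm : Ap0 H (q + r - 1) (dJ m).
  by have := Ap0_dJ Am; rewrite -addrA.
have Alc : Ap0 H (p + q + r - 1 - 1) (wedge l c).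
  by have := Ap0_wedge Al Ac; congr Ap0; ring.
have Aam : Ap0 H (p + q + r - 1 - 1) (wedge a m).
  by have := Ap0_wedge Aa Am; congr Ap0; ring.
(* Because [dJ a] and [dJ c] vanish, the Leibniz rule leaves just these two terms, with [bar a] as
   the Massey sign. *)
have E : wedge (dJ l) c - wedge (bar a) (dJ m) = dJ (wedge l c - wedge a m).
  rewrite twistD twistN (dJ_wedge Al Ac) (dJ_wedge Aa Am) dJa dJc.
  by rewrite wedge0l wedge0r add0r addr0.
have [||t At Et] :=
  @ddJ_exactJ _ _ _ H (p + q + r - 1) (wedge l c - wedge a m) L.
- exact: Ap0B.
(* Closedness: the two differentials are (ab)c and a(bc). *)
- rewrite -E twistD twistN (d_wedge AJl Ac) (d_wedge (Ap0_bar Aa) AJm).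
  rewrite (d_bar Aa) da dc -El -Em dl0 dm0 barK wedge0r addr0 wedgeNl.
  rewrite bar0 wedge0l oppr0 add0r wedgeA; exact: subrr.
exists (dJ l), (dJ m), (dJ t); split=> //.
- by have := Ap0_dJ At; congr Ap0; ring.
- by rewrite -El.
by split; [rewrite -Em|rewrite E].
Qed.

(** Masks selecting a number of arguments other than [p] contribute zero, and on the others [bar] is
    the constant sign. *)
Lemma bar_sign (p : nat) a b : Ap0 H p a ->
  wedge (bar a) b = (-1) ^+ p \*o wedge a b.
Proof.
move=> Aa; apply/funext => s; rewrite /= /wedge mulr_sumr.
apply: eq_bigr => m _; rewrite /bar.
have [sp|sp] := eqVneq (size (mask m s)) p; first by rewrite sp; ring.
by rewrite (Ap0_degree Aa) ?eqz_nat //; ring.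
Qed.

Lemma cup_span1 p q u v : cocycles H p u -> cocycles H q v ->
  cup_span H p q (wedge u v).
Proof.
move=> cu cv; exists [:: (u, v)]; split; last by rewrite big_seq1.
by move=> x; rewrite inE => /eqP ->.
Qed.

Lemma cocyclesP p u : cocycles H p u <-> Ap0 H p u /\ d u = 0.
Proof.
by split=> -[Au du]; split=> //; [rewrite -(del_twist Au)|rewrite /= (del_twist Au)].
Qed.

End Massey.

Theorem corollary4p7 (R : realType) (n : nat) (M : manifold R n)
    (H : hypercomplex M) :
  compact [set: M] -> ddJ_lemma H -> massey_vanish H.
Proof.
move=> _ L p q r a b c l m /cocyclesP[Aa da] /cocyclesP[Ab db] /cocyclesP[Ac dc].
rewrite !PoszD => Al Am; rewrite (del_twist Al) (del_twist Am) => ab bc.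
have [x Ax dJa] := delJ_closed_repr L Aa da.
have [y Ay dJb] := delJ_closed_repr L Ab db.
have [z Az dJc] := delJ_closed_repr L Ac dc.
have /= [] := massey_change Aa Ab Ac Al Am Ax Ay Az da db dc ab bc.
have [Aa' da'] := closed_add_exact Aa Ax da.
have [Ab' db'] := closed_add_exact Ab Ay db.
have [Ac' dc'] := closed_add_exact Ac Az dc.
set a' := a + _ in dJa Aa' da' *; set b' := b + _ in dJb Ab' db' *.
set c' := c + _ in dJc Ac' dc' *.
set l' := l + _ + _; set m' := m + _ + _ => dl' dm' E.
have Al' : Ap0 H (p%:Z + q - 1) l'.
  apply: Ap0D; first apply: Ap0D => //.
    by have := Ap0_wedge Ax Ab'; congr Ap0; ring.
  by have := Ap0_wedge (Ap0_bar Aa) Ay; congr Ap0; ring.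
have Am' : Ap0 H (q%:Z + r - 1) m'.
  apply: Ap0D; first apply: Ap0D => //.
    by have := Ap0_wedge Ay Ac'; congr Ap0; ring.
  by have := Ap0_wedge (Ap0_bar Ab) Az; congr Ap0; ring.
(* The primitives [l1] and [m1] need not be [l'] and [m']; their closed differences produce the
   indeterminacy. *)
have [||l1 [m1 [t [Al1 Am1 At dl1 [dm1 Et]]]]] :=
  massey_exact L Aa' Ab' Ac' da' db' dc' dJa dJb dJc.
- by exists l'.
- by exists m'.
rewrite -(bar_sign _ Aa).
set e := wedge (bar l) z + wedge (bar x) m' in E.
have Ae : Ap0 H (p%:Z + q + r - 2) e.
  apply: Ap0D.
    by have := Ap0_wedge (Ap0_bar Al) Az; congr Ap0; ring.
  by have := Ap0_wedge (Ap0_bar Ax) Am'; congr Ap0; ring.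
(* By [E] the given cocycle is that of [l'], [m'] minus d e, and by [Et] the one of [l1], [m1] is d
   t. The two remaining products account for passing from [l1], [m1] to [l'], [m']. *)
exists (twist (part (cI H) true) id (t - e)), (wedge (l' - l1) c'),
  (wedge (- bar a') (m' - m1)); split.
- have Ate := Ap0B At Ae; exists (t - e); last exact: del_twist Ate.
  by move: Ate; congr Ap0; rewrite !PoszD; ring.
- apply: cup_span1; apply/cocyclesP; split=> //; rewrite ?PoszD.
    exact: Ap0B.
  by rewrite twistD twistN dl1 dl' subrr.
- apply: cup_span1; apply/cocyclesP; split; rewrite ?PoszD.
  + exact/Ap0N/Ap0_bar.
  + by rewrite twistN (d_bar Aa') da' bar0 !oppr0.
  + exact: Ap0B.
  by rewrite twistD twistN dm1 dm' subrr.
clearbody e l' m' a' c'.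
rewrite twistD twistN -Et !wedgeDl !wedgeDr !wedgeNl !wedgeNr.
rewrite -[LHS](addrK (twist (part (cI H) true) id e)) -E.
by apply/funext => s; rewrite !dformE; ring.
Qed.
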